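(* Let $p_1,p_2,\dots,p_n$ be different real, positive numbers. Then the Mellin transform $$\prod_{j=1}^{n}\Gamma(s+p_j)=\int_{0}^{\infty}u^{s-1}g\left(u;\{p_j\}_{1\le j\le n}\right)du$$ has the inverse $$g\left(u;\{p_j\}_{1\le j\le n}\right)=\frac{1}{2\pi i}\int_{c-i\infty}^{c+i\infty}\prod_{j=1}^{n}\Gamma(s+p_j)\,u^{-s}ds\qquad\text{with }c>0,$$ which equals $$g\left(u;\{p_j\}_{1\le j\le n}\right)=\sum_{j=1}^{n}\frac{(-1)^{j-1}\pi^{n-1}u^{p_j}}{\prod_{m=1}^{j-1}\sin\pi(p_j-p_m)\prod_{m=j+1}^{n}\sin\pi(p_m-p_j)}\sum_{q=0}^{\infty}\frac{(-1)^{nq}u^{q}}{q!\prod_{m=1;\,m\neq j}^{n}\Gamma(1+q+p_j-p_m)} .$$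
   Context: $\Gamma$ is the Gamma function. By convention $\prod_{m=a}^{b}f_m=1$ if $b<a$.
   Formalization: The series formula is stated only when no difference p_i - p_j (i ≠ j) is an integer, since otherwise a factor sin π(p_j - p_m) in its denominator is zero; the Mellin transform and its inverse are stated for all distinct positive p_j. *)

(* Defs.v *)
From HB Require Import structures.
From mathcomp Require Import all_boot all_order all_algebra archimedean.
From mathcomp Require Import complex.
From mathcomp Require Import all_classical all_reals all_analysis.

Set Implicit Arguments.
Unset Strict Implicit.
Unset Printing Implicit Defensive.

Import Order.TTheory GRing.Theory Num.Theory.
Import numFieldNormedType.Exports.

Local Open Scope classical_set_scope.
Local Open Scope complex_scope.
Local Open Scope ring_scope.

Definition cintegrable (R : realType) (D : set R) (f : R -> R[i]) : Prop :=
  (@lebesgue_measure R).-integrable D (EFin \o (fun x => complex.Re (f x))) /\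
  (@lebesgue_measure R).-integrable D (EFin \o (fun x => complex.Im (f x))).

(* Meaningful only when [cintegrable D f]. *)
Definition cintegral (R : realType) (D : set R) (f : R -> R[i]) : R[i] :=
  (\int[@lebesgue_measure R]_(x in D) complex.Re (f x)) +i*
  (\int[@lebesgue_measure R]_(x in D) complex.Im (f x)).

(* Principal value of u^z = exp (z ln u), for u > 0. *)
Definition cpow (R : realType) (u : R) (z : R[i]) : R[i] :=
  (expR (complex.Re z * ln u))%:C *
  (cos (complex.Im z * ln u) +i* sin (complex.Im z * ln u)).

Definition mellin_integrand (R : realType) (f : R -> R[i]) (s : R[i]) :
  R -> R[i] := fun u => cpow u (s - 1) * f u.

Definition mellin (R : realType) (f : R -> R[i]) (s : R[i]) : R[i] :=
  cintegral `]0, +oo[ (mellin_integrand f s).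

(* Euler's integral, which converges for Re z > 0. *)
Definition euler_integral (R : realType) (z : R[i]) : R[i] :=
  mellin (fun t => (expR (- t))%:C) z.

(* Euler's integral for Re z > 0, continued to Re z <= 0 by
   Gamma z = Gamma (z + N) / (z (z + 1) ... (z + N - 1)) with Re z + N > 0.
   At the poles 0, -1, -2, ... the quotient is a division by zero, hence 0. *)
Definition Gamma (R : realType) (z : R[i]) : R[i] :=
  if 0 < complex.Re z then euler_integral z
  else let N := (Num.truncn `|complex.Re z|).+1 in
       euler_integral (z + N%:R) / \prod_(k < N) (z + k%:R).

(* The integrand F(s) u^(-s) on the line s = c + i t, as a function of t. *)
Definition bromwich_integrand (R : realType) (F : R[i] -> R[i]) (c u : R) :
  R -> R[i] := fun t => F (c +i* t) * cpow u (- (c +i* t)).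

(* (2 pi i)^-1 times the integral over the line Re s = c; since ds = i dt,
   the latter is i times an integral over the real line. *)
Definition inverse_mellin (R : realType) (F : R[i] -> R[i]) (c u : R) : R[i] :=
  (2 * pi%:C * (0 +i* 1))^-1 *
  ((0 +i* 1) * cintegral setT (bromwich_integrand F c u)).

Definition gamma_product (R : realType) (n : nat) (p : 'I_n -> R) (s : R[i]) :
  R[i] := \prod_(j < n) Gamma (s + (p j)%:C).

(* Indices start at 0 here, so (-1)^(j-1) becomes (-1)^j. *)
Definition residue_coef (R : realType) (n : nat) (p : 'I_n -> R) (u : R)
    (j : 'I_n) : R :=
  (-1) ^+ j * pi ^+ n.-1 * u `^ p j /
  ((\prod_(m < n | (m < j)%N) sin (pi * (p j - p m))) *
   (\prod_(m < n | (j < m)%N) sin (pi * (p m - p j)))).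

(* [R[i]^o] rather than [R[i]] since only the former has the norm topology as a
   canonical structure, needed for the convergence of the series. *)
Definition residue_term (R : realType) (n : nat) (p : 'I_n -> R) (u : R)
    (j : 'I_n) (q : nat) : R[i]^o :=
  ((-1) ^+ (n * q) * u ^+ q)%:C /
  (q`!%:R * \prod_(m < n | m != j) Gamma (1 + q%:R + p j - p m)%:C).

(* Main.v *)
(** In the additive coordinate [u = exp x], the Mellin transform on [Re s = c] is the Fourier
    transform of [exp (c x) g (exp x)].  For [N : nat] the function
    [exp (p x) (exp (- w) - \sum_(k < N) (- w)^k / k!)], [w = exp x], has Mellin
    transform [Gamma (s + p)] in the strip [- N < Re s + p < 1 - N] (the half plane
    [Re s + p > 0] when [N = 0]); convolving these gives [\prod_j Gamma (s + p_j)] on the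
    intersection of the strips.  Fourier inversion, by Abel summation with the
    Poisson kernel, then yields the first two claims with all [N_j = 0].

    For the series, the line of integration moves to the left across one pole at a
    time.  Crossing the pole [- (p_j + q)] replaces [N_j = q] by [q + 1] in the
    [j]-th factor only, and the difference of the two truncations is a pure
    exponential, whose convolution with the other factors is the residue; no
    contour integral is needed.  By the functional equation, moving the line by [k]
    divides the product by at least [k!] while [u^(- s)] gains a factor [u^k], so
    the remaining integral tends to [0].  The residues take the stated form by the
    reflection formula, which comes from the log-convexity of Gamma together with
    the recurrence in [k] of the integrals of [cos^(2k) t cos (2 a t)] over
    [0 <= t <= pi / 2]; the latter play the role of Euler's product for the sine. *)

Require Import Defs.
From HB Require Import structures.
From mathcomp Require Import all_boot all_order all_algebra archimedean.
From mathcomp Require Import complex.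
From mathcomp Require Import all_classical all_reals all_analysis.
From mathcomp Require Import measurable_realfun.
From mathcomp Require Import ring lra.

Set Implicit Arguments.
Unset Strict Implicit.
Unset Printing Implicit Defensive.

Import Order.TTheory GRing.Theory Num.Theory.
Import numFieldNormedType.Exports.

Local Open Scope classical_set_scope.
Local Open Scope complex_scope.
Local Open Scope ring_scope.

(** * Integrals over the real line *)

(** Truncating the exponential is the Cauchy-Saalschuetz representation of Gamma between two
    consecutive poles: dropping Taylor terms restores convergence there and keeps the functional
    equation. On a fixed choice of strips one function serves all abscissas, which replaces Cauchy's
    theorem between two lines. The obstacle is absolute integrability on vertical lines. In place of
    Stirling's formula, two uses of the functional equation give decay like 1 / (1 + t^2) for one
    factor; each further factor only has to be bounded. Likewise the inversion theorem is proved for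
    a single factor, and a convolution inherits its inversion formula by Fubini. Non-integral
    differences p_i - p_j keep the poles of different factors apart, so that at a crossing the pole
    lies inside the strips of all the other factors and the residue is their transform at that
    point. It contains Gamma (p_m - p_j - q), whereas the stated series has 1 / Gamma (1 + q + p_j -
    p_m); the reflection formula links the two and produces the sines. *)

Section real_line_integrals.
Context {R : realType}.
Notation mu := (@lebesgue_measure R).
Notation L1 f := (mu.-integrable setT (EFin \o f)).
Notation Int f := (\int[mu]_x f x).
Implicit Types (f g : R -> R) (a b c e x y t : R).

Lemma L1_measurable f : L1 f -> measurable_fun setT f.
Proof. by move=> /integrableP[/measurable_EFinP]. Qed.

Lemma L1_dom f g : measurable_fun setT f -> L1 g ->
  (forall x, `|f x| <= g x) -> L1 f.
Proof.
move=> mf ig fg; apply: le_integrable ig => //.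
  exact/measurable_EFinP.
by move=> x _; rewrite /= lee_fin (le_trans (fg x))// ler_norm.
Qed.

Lemma L1_norm f : L1 f -> L1 (fun x => `|f x|).
Proof.
move=> lf; have mf := L1_measurable lf.
apply: (le_integrable _ _ _ lf) => //.
  by apply/measurable_EFinP; exact: measurableT_comp.
by move=> x _ /=; rewrite lee_fin normr_id.
Qed.

Lemma L1D f g : L1 f -> L1 g -> L1 (fun x => f x + g x).
Proof. by move=> lf lg; have := integrableD measurableT lf lg. Qed.

Lemma L1B f g : L1 f -> L1 g -> L1 (fun x => f x - g x).
Proof. by move=> lf lg; have := integrableB measurableT lf lg. Qed.

Lemma L1Z c f : L1 f -> L1 (fun x => c * f x).
Proof. by move=> lf; have := integrableZl measurableT c lf. Qed.

Lemma L1_mul_bounded f g M : L1 f -> measurable_fun setT g ->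
  (forall x, `|g x| <= M) -> L1 (fun x => f x * g x).
Proof.
move=> lf mg gM; apply: (@L1_dom _ (fun x => M * `|f x|)).
- exact: measurable_funM (L1_measurable lf) mg.
- exact/L1Z/L1_norm.
- by move=> x; rewrite normrM mulrC ler_wpM2r.
Qed.

Lemma IntD f g : L1 f -> L1 g -> Int (fun x => f x + g x) = Int f + Int g.
Proof. by move=> lf lg; rewrite RintegralD. Qed.

Lemma IntB f g : L1 f -> L1 g -> Int (fun x => f x - g x) = Int f - Int g.
Proof. by move=> lf lg; rewrite RintegralB. Qed.

Lemma IntZ c f : L1 f -> Int (fun x => c * f x) = c * Int f.
Proof. by move=> lf; rewrite RintegralZl. Qed.

Lemma IntZr c f : L1 f -> Int (fun x => f x * c) = Int f * c.
Proof. by move=> lf; rewrite RintegralZr. Qed.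

Lemma le_Int f g : L1 f -> L1 g -> (forall x, f x <= g x) -> Int f <= Int g.
Proof. by move=> lf lg fg; exact: le_Rintegral. Qed.

Lemma normr_Int_le f g : L1 f -> L1 g -> (forall x, `|f x| <= g x) ->
  `|Int f| <= Int g.
Proof.
move=> lf lg fg; apply: (le_trans (le_normr_Rintegral _ _)) => //.
by apply: le_Int => //; exact: L1_norm.
Qed.

(** Uniqueness of Lebesgue measure: multiplied by [|a|], the image measure gives each []x, y]] its
    length. The preimage is an interval closed on the right or on the left according to the sign of
    [a]. *)
Lemma lebesgue_measure_affine a b (A : set R) : a != 0 -> measurable A ->
  pushforward mu ((fun x => a * x + b) : _ -> measurableTypeR R) A =
  (`|a|^-1%:E * mu A)%E.
Proof.
move=> a0 mA.
have na0 : 0 < `|a| by rewrite normr_gt0.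
have mf : measurable_fun setT ((fun x => a * x + b) : R -> measurableTypeR R).
  by apply: measurable_funD => //; exact: measurable_funM.
pose nu' := mscale (NngNum (normr_ge0 a)) (pushforward mu ((fun x => a * x + b) : _ -> measurableTypeR R)).
pose nu := nu' mf.
have H : mu A = nu A.
  apply: lebesgue_measure_unique => //= _ [[x y]] _ <-.
  rewrite /nu /nu' /mscale /= /pushforward.
  have -> : (fun z => a * z + b) @^-1` `]x, y] =
     [set` if 0 < a then `](x - b) / a, (y - b) / a] else `[(y - b) / a, (x - b) / a[].
    case: ifPn => ha; apply/seteqP; split => z /=; rewrite !in_itv/= => /andP[].
    - by rewrite ltr_pdivrMr// ler_pdivlMr// !(mulrC z) => h1 h2; apply/andP; split; lra.
    - by rewrite ltr_pdivrMr// ler_pdivlMr// !(mulrC z) => h1 h2; apply/andP; split; lra.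
    - have {}ha : a < 0 by rewrite lt_neqAle a0 leNgt.
      by rewrite ler_ndivrMr// ltr_ndivlMr// !(mulrC z) => h1 h2; apply/andP; split; lra.
    - have {}ha : a < 0 by rewrite lt_neqAle a0 leNgt.
      by rewrite ler_ndivrMr// ltr_ndivlMr// !(mulrC z) => h1 h2; apply/andP; split; lra.
  have -> : lebesgue_measure (`]x, y] : set R) = if x < y then (y - x)%:E else 0%E.
    by rewrite lebesgue_measure_itv/= lte_fin.
  have [ha|ha0] := ltP 0 a; rewrite lebesgue_measure_itv/= lte_fin.
    rewrite ltr_pM2r ?invr_gt0// ltrD2r; case: ifP => xy; last by rewrite mule0.
    by rewrite -EFinB -EFinM gtr0_norm//; congr EFin; field.
  have ha : a < 0 by rewrite lt_neqAle a0.
  rewrite ltr_nM2r ?invr_lt0// ltrD2r; case: ifP => xy; last by rewrite mule0.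
  by rewrite -EFinB -EFinM ltr0_norm//; congr EFin; field.
rewrite H /nu /nu' /mscale /= muleA -EFinM mulVf ?mul1e//.
by rewrite gt_eqF.
Qed.

Lemma L1_affine f a b : a != 0 -> L1 f -> L1 (fun x => f (a * x + b)).
Proof.
move=> a0 lf; have mf := L1_measurable lf.
have ma : measurable_fun setT ((fun x => a * x + b) : R -> measurableTypeR R).
  by apply: measurable_funD => //; exact: measurable_funM.
apply/integrableP; split.
  by apply/measurable_EFinP; apply: (measurableT_comp mf ma).
have mf' : measurable_fun setT (fun x => (`|f x|)%:E).
  by apply/measurable_EFinP; exact: measurableT_comp.
have := @ge0_integral_pushforward _ _ (measurableTypeR R) (measurableTypeR R) R _ ma mu setT (fun x => (`|f x|)%:E) measurableT mf' (fun y _ => normr_ge0 _).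
rewrite preimage_setT /comp /= => <-.
have na : 0 <= `|a|^-1 by rewrite invr_ge0.
rewrite (@eq_measure_integral _ _ _ _ (mscale (NngNum na) mu)); last first.
  by move=> A mA _; exact: lebesgue_measure_affine.
rewrite ge0_integral_mscale//.
by apply: lte_mul_pinfty => //; case/integrableP : lf.
Qed.

Lemma Int_affine f a b : a != 0 -> L1 f ->
  Int (fun x => f (a * x + b)) = `|a|^-1 * Int f.
Proof.
move=> a0 lf; have mf := L1_measurable lf.
have la := L1_affine b a0 lf.
have ma : measurable_fun setT ((fun x => a * x + b) : R -> measurableTypeR R).
  by apply: measurable_funD => //; exact: measurable_funM.
have mf' : measurable_fun setT (EFin \o f) by exact/measurable_EFinP.
have := @integral_pushforward _ _ (measurableTypeR R) (measurableTypeR R) R _ ma mu setT (EFin \o f) mf'.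
rewrite preimage_setT => /(_ la measurableT) H.
rewrite /Rintegral -[X in fine X = _]H.
have na : 0 <= `|a|^-1 by rewrite invr_ge0.
rewrite [in LHS](@eq_measure_integral _ _ _ _ (mscale (NngNum na) mu)); last first.
  by move=> A mA _; exact: lebesgue_measure_affine.
have pf := integrable_pos_fin_num measurableT lf.
have nf := integrable_neg_fin_num measurableT lf.
rewrite [in LHS]integralE !ge0_integral_mscale//; last 2 first.
  exact: measurable_funeneg.
  exact: measurable_funepos.
rewrite fineB ?fin_numM// !fineM//= -mulrBr; congr (_ * _).
by rewrite -fineB// -integralE.
Qed.

Lemma L1_shift f y : L1 f -> L1 (fun x => f (x - y)).
Proof.
move=> lf; rewrite (_ : (fun x => _) = (fun x => f (1 * x + (- y)))).
  by apply: L1_affine => //; rewrite oner_neq0.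
by apply/funext => x; rewrite mul1r.
Qed.

Lemma Int_shift f y : L1 f -> Int (fun x => f (x - y)) = Int f.
Proof.
move=> lf.
transitivity (Int (fun x => f (1 * x + (- y)))).
  by apply: eq_Rintegral => x _; rewrite mul1r.
by rewrite Int_affine ?oner_neq0// normr1 invr1 mul1r.
Qed.

Lemma L1_reflect f y : L1 f -> L1 (fun x => f (y - x)).
Proof.
move=> lf; rewrite (_ : (fun x => _) = (fun x => f (-1 * x + y))).
  by apply: L1_affine => //; rewrite oppr_eq0 oner_neq0.
by apply/funext => x; rewrite mulN1r addrC.
Qed.

Lemma Int_reflect f y : L1 f -> Int (fun x => f (y - x)) = Int f.
Proof.
move=> lf.
transitivity (Int (fun x => f (-1 * x + y))).
  by apply: eq_Rintegral => x _; rewrite mulN1r addrC.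
by rewrite Int_affine ?oppr_eq0 ?oner_neq0// normrN1 invr1 mul1r.
Qed.

(** By Tonelli, the bound [m] on the inner integrals of [|F|] gives integrability on the product.
    Since every section is integrable, not just almost every one, both iterated integrals can be
    treated as integrals of real functions. *)
Lemma Fubini_L1 (F : R -> R -> R) (m : R -> R) :
  measurable_fun setT (fun z : R * R => F z.1 z.2) ->
  (forall x, L1 (F x)) -> (forall y, L1 (F ^~ y)) -> L1 m ->
  (forall y, Int (fun x => `|F x y|) <= m y) ->
  [/\ L1 (fun x => Int (F x)), L1 (fun y => Int (F ^~ y)) &
   Int (fun x => Int (F x)) = Int (fun y => Int (F ^~ y))].
Proof.
move=> mF l1 l2 lm Fm.
pose G := fun z : R * R => (F z.1 z.2)%:E.
have mG : measurable_fun setT G by exact/measurable_EFinP.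
have iG : (mu \x mu)%E.-integrable setT G.
  apply/integrable21ltyP => //.
  have /integrableP[_] := lm.
  apply: le_lt_trans; apply: ge0_le_integral => //.
  - by move=> x _; exact: integral_ge0.
  - apply: (@measurable_fun_fubini_tonelli_G _ _ _ _ R mu (fun z => `|G z|%E)) => //.
    exact: measurableT_comp.
  - by apply/measurable_EFinP; apply: measurableT_comp => //; exact: L1_measurable.
  - move=> y _; rewrite /G /=.
    have := Fm y; rewrite -lee_fin /Rintegral fineK.
      by move=> /le_trans; apply; rewrite lee_fin ler_norm.
    apply: integrable_fin_num => //.
    exact: (L1_norm (l2 y)).
have E1 x : fubini_F mu G x = (Int (F x))%:E.
  by rewrite /fubini_F /G /Rintegral/= fineK//; apply: integrable_fin_num => //; exact: l1.
have E2 y : fubini_G mu G y = (Int (F ^~ y))%:E.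
  by rewrite /fubini_G /G /Rintegral/= fineK//; apply: integrable_fin_num => //; exact: l2.
have J1 := integrable_fubini_F iG.
have J2 := measurable_fubini_G iG.
have K1 := integral12_prod_meas1 iG.
have K2 := integral21_prod_meas1 iG.
have {}J1 : L1 (fun x => Int (F x)).
  by rewrite (_ : EFin \o _ = fubini_F mu G)//; apply/funext => x; rewrite E1.
have {}J2 : measurable_fun setT (EFin \o (fun y => Int (F ^~ y))).
  by rewrite (_ : EFin \o _ = fubini_G mu G)//; apply/funext => x; rewrite E2.
have {}K1 : (\int[mu]_x (Int (F x))%:E = \int[mu \x mu]_z G z)%E.
  by rewrite -K1; apply: eq_integral => x _; rewrite -E1.
have {}K2 : (\int[mu]_x (Int (F ^~ x))%:E = \int[mu \x mu]_z G z)%E.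
  by rewrite -K2; apply: eq_integral => x _; rewrite -E2.
split; first exact: J1.
  apply: (@L1_dom _ m) => //; first exact/measurable_EFinP.
  by move=> y; exact: le_trans (le_normr_Rintegral _ _) (Fm y).
by rewrite /Rintegral; congr fine; exact: etrans K1 (esym K2).
Qed.

(** Dominated convergence, [|f|] dominating its restrictions to the [E n]. Together with
    [integrable_exhaust], which is monotone convergence, this reduces improper integrals to compact
    pieces, where the fundamental theorem and substitution apply. *)
Lemma cvg_Rintegral_exhaust (D : set R) (E : (set R)^nat) f :
  measurable D -> (forall n, measurable (E n)) ->
  {homo E : n m / (n <= m)%N >-> (n <= m)%O} -> \bigcup_n E n = D ->
  mu.-integrable D (EFin \o f) ->
  (fun n => \int[mu]_(x in E n) f x) @ \oo --> \int[mu]_(x in D) f x.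
Proof.
move=> mD mE ndE ED lf.
have sE n : E n `<=` D by rewrite -ED; exact: bigcup_sup.
have /integrableP[mf _] := lf.
apply: fine_cvg; rewrite fineK; last exact: integrable_fin_num.
rewrite (_ : (fun n => _) = fun n => (\int[mu]_(x in D) ((EFin \o f) \_ (E n)) x)%E); last first.
  by apply/funext => n; rewrite -integral_mkcondr (setIidr (sE n)).
apply: (@dominated_cvg _ _ R mu D mD (fun n => (EFin \o f) \_ (E n)) (EFin \o f) (fun x => (`|f x|)%:E)).
- move=> n; apply/measurable_restrict => //; first exact: mE.
  by apply: measurable_funS mf.
- move=> x; rewrite -ED => -[N _ ENx]; apply: cvg_near_cst.
  near=> n; rewrite patchE mem_set//.
  have /subsetPset : (E N <= E n)%O by apply: ndE; near: n; exact: nbhs_infty_ge.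
  exact.
- by [].
- exact: integrable_abse lf.
- move=> n x _; rewrite patchE; case: ifPn => _ //=.
  by rewrite normr0 lee_fin.
Unshelve. all: by end_near. Qed.

Lemma integrable_exhaust (D : set R) (E : (set R)^nat) f M :
  measurable D -> (forall n, measurable (E n)) ->
  {homo E : n m / (n <= m)%N >-> (n <= m)%O} -> \bigcup_n E n = D ->
  measurable_fun D f ->
  (forall n, (\int[mu]_(x in E n) `|f x|%:E <= M%:E)%E) ->
  mu.-integrable D (EFin \o f).
Proof.
move=> mD mE ndE ED mf fM.
have sE n : E n `<=` D by rewrite -ED; exact: bigcup_sup.
have maf : measurable_fun D (fun x => (`|f x|)%:E).
  by apply/measurable_EFinP; exact: measurableT_comp.
apply/integrableP; split; first exact/measurable_EFinP.
have H : (\int[mu]_(x in E n) (`|f x|)%:E)%E @[n --> \oo] --> (\int[mu]_(x in \bigcup_n E n) (`|f x|)%:E)%E.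
  apply: ge0_nondecreasing_set_cvg_integral => //.
  by move=> n; apply: measurable_funS maf.
rewrite ED in H; apply: (@le_lt_trans _ _ M%:E); last exact: ltry.
rewrite -(cvg_lim _ H)//; apply: lime_le; first by apply/cvg_ex; eexists; exact: H.
exact: nearW.
Qed.

Let seg n : set R := [set` `[- n%:R, n%:R]].

Lemma seg_nondecreasing : {homo seg : n m / (n <= m)%N >-> (n <= m)%O}.
Proof.
move=> n m nm; apply/subsetPset => x; rewrite /seg /= !in_itv/= => /andP[h1 h2].
have nm' : (n%:R : R) <= m%:R by rewrite ler_nat.
by rewrite (le_trans _ h1) ?lerN2//= (le_trans h2).
Qed.

Lemma bigcup_seg : \bigcup_n seg n = setT.
Proof.
apply/seteqP; split => // x _.
exists (Num.truncn `|x|).+1 => //; rewrite /seg /= in_itv/= -ler_norml.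
by rewrite ltW// truncnS_gt.
Qed.

Lemma integral_segment_FTC F f a b : a <= b -> continuous f ->
  (forall x, is_derive x 1 F (f x)) ->
  (\int[mu]_(x in `[a, b]) (f x)%:E = (F b - F a)%:E)%E.
Proof.
move=> ab cf dF; have [ba|ltab] := leP b a.
  have -> : b = a by apply/eqP; rewrite eq_le ab ba.
  by rewrite set_itv1 integral_set1 subrr.
rewrite (@continuous_FTC2 _ f F)// ?EFinB//.
- exact: continuous_subspaceT.
- have cF x : {for x, continuous F}.
    by apply: differentiable_continuous; apply/derivable1_diffP; case: (dF x).
  split; first by move=> x _; case: (dF x).
  + by apply: cvg_at_right_filter; exact: cF.
  + by apply: cvg_at_left_filter; exact: cF.
- by move=> x _; rewrite derive1E; case: (dF x).
Qed.

Lemma Int_FTC F f l : continuous f -> (forall x, is_derive x 1 F (f x)) ->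
  L1 f -> (fun n => F n%:R - F (- n%:R)) @ \oo --> l -> Int f = l.
Proof.
move=> cf dF lf Fl.
have := cvg_Rintegral_exhaust measurableT (fun n => measurable_itv _) seg_nondecreasing bigcup_seg lf.
rewrite (_ : (fun n => _) = (fun n => F n%:R - F (- n%:R))); last first.
  apply/funext => n; rewrite /Rintegral (integral_segment_FTC _ cf dF)//.
  by rewrite (@le_trans _ _ 0) ?oppr_le0.
by move=> /(cvg_unique _ Fl) ->.
Qed.

Lemma L1_FTC F f M : continuous f -> (forall x, is_derive x 1 F (f x)) ->
  (forall x, 0 <= f x) -> (forall x, `|F x| <= M) -> L1 f.
Proof.
move=> cf dF f0 FM.
apply: (@integrable_exhaust _ _ _ (M + M) measurableT (fun n => measurable_itv _) seg_nondecreasing bigcup_seg).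
  exact: continuous_measurable_fun.
move=> n; under eq_integral do rewrite ger0_norm//.
rewrite (integral_segment_FTC _ cf dF) ?lee_fin.
  apply: le_trans (ler_norm _) _.
  by apply: (le_trans (ler_normB _ _)); rewrite lerD.
by rewrite (@le_trans _ _ 0) ?oppr_le0.
Qed.

(** The substitution [u = exp x] is made between [exp (- n)] and [exp n], and both sides then
    exhaust their domains. Integrability on the left comes from the same substitution for [|f|],
    which bounds the pieces by the integral of [|f|]. *)
Lemma exp_substitution f : continuous f -> L1 f ->
  mu.-integrable `]0, +oo[ (EFin \o (fun u => f (ln u) / u)) /\
  \int[mu]_(u in `]0, +oo[) (f (ln u) / u) = Int f.
Proof.
move=> cf lf.
pose E n : set R := [set` `[expR (- n%:R), expR n%:R]].
have mE n : measurable (E n) by exact: measurable_itv.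
have ndE : {homo E : n m / (n <= m)%N >-> (n <= m)%O}.
  move=> n m nm; apply/subsetPset => x; rewrite /E /= !in_itv/= => /andP[h1 h2].
  have nm' : (n%:R : R) <= m%:R by rewrite ler_nat.
  by rewrite (le_trans _ h1) ?ler_expR ?lerN2//= (le_trans h2)// ler_expR.
have ED : \bigcup_n E n = [set` `]0, +oo[].
  apply/seteqP; split => x.
    by move=> [n _]; rewrite /E /= !in_itv/= andbT => /andP[+ _]; apply: lt_le_trans; exact: expR_gt0.
  rewrite /= in_itv/= andbT => x0.
  exists (Num.truncn `|ln x|).+1 => //; rewrite /E /= in_itv/=.
  rewrite -{2 3}(@lnK _ x) ?posrE// !ler_expR -ler_norml.
  by rewrite ltW// truncnS_gt.
have dE : ((@expR R)^`())%classic = expR by apply/funext => x; rewrite derive1E derive_val.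
have sub (h : R -> R) n : continuous h ->
  (\int[mu]_(u in E n) (h (ln u) / u)%:E = \int[mu]_(x in seg n) (h x)%:E)%E.
  move=> ch; rewrite /E (@integration_by_substitution_increasing _ expR (fun u => h (ln u) / u)).
  - apply: eq_integral => x _ /=; rewrite dE fctE /= expRK.
    by rewrite divfK// gt_eqF ?expR_gt0.
  - by rewrite (@le_trans _ _ 0) ?oppr_le0.
  - by move=> x y _ _; rewrite ltr_expR.
  - by move=> x _; rewrite dE; exact: continuous_expR.
  - rewrite dE; apply/cvg_ex; eexists; apply: cvg_at_right_filter; exact: continuous_expR.
  - rewrite dE; apply/cvg_ex; eexists; apply: cvg_at_left_filter; exact: continuous_expR.
  - split.
    + by move=> x _; exact: derivable_expR.
    + by apply: cvg_at_right_filter; exact: continuous_expR.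
    + by apply: cvg_at_left_filter; exact: continuous_expR.
  - apply: continuous_in_subspaceT => x; rewrite inE/= in_itv/= => /andP[h1 _].
    have x0 : 0 < x by apply: lt_le_trans h1; exact: expR_gt0.
    apply: cvgM; last by apply: cvgV; [rewrite gt_eqF|exact: cvg_id].
    by apply: continuous_comp; [exact: continuous_ln|exact: ch].
have i1 : mu.-integrable `]0, +oo[ (EFin \o (fun u => f (ln u) / u)).
  apply: (@integrable_exhaust _ E _ (Int (fun x => `|f x|))) => //.
    apply: open_continuous_measurable_fun => // x; rewrite inE/= in_itv/= andbT => x0.
    apply: cvgM; last by apply: cvgV; [rewrite gt_eqF|exact: cvg_id].
    by apply: continuous_comp; [exact: continuous_ln|exact: cf].
  move=> n.
  have -> : (\int[mu]_(u in E n) `|f (ln u) / u|%:E = \int[mu]_(u in E n) (`|f (ln u)| / u)%:E)%E.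
    apply: eq_integral => u; rewrite inE /E /= in_itv/= => /andP[h1 _].
    have u0 : 0 < u by apply: lt_le_trans h1; exact: expR_gt0.
    by rewrite normrM (@gtr0_norm _ u^-1)// invr_gt0.
  rewrite (sub (fun x => `|f x|)); last first.
    by move=> x; apply: continuous_comp; [exact: cf|exact: norm_continuous].
  rewrite /Rintegral fineK; last exact: integrable_fin_num (L1_norm lf).
  apply: ge0_subset_integral => //; first exact: measurable_itv.
    by apply/measurable_EFinP; apply: measurableT_comp => //; exact: L1_measurable.
split => //.
have H1 := cvg_Rintegral_exhaust (measurable_itv _) mE ndE ED i1.
have H2 := cvg_Rintegral_exhaust measurableT (fun n => measurable_itv _) seg_nondecreasing bigcup_seg lf.
have EQ : (fun n => \int[mu]_(x in E n) (f (ln x) / x)) = (fun n => \int[mu]_(x in seg n) f x).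
  by apply/funext => n; rewrite /Rintegral sub.
rewrite EQ in H1.
by rewrite (cvg_unique _ H1 H2).
Qed.

Lemma Int_dominated_cvg (F : nat -> R -> R) f g :
  (forall n, measurable_fun setT (F n)) ->
  (forall x, (fun n => F n x) @ \oo --> f x) -> L1 g ->
  (forall n x, `|F n x| <= g x) -> (fun n => Int (F n)) @ \oo --> Int f.
Proof.
move=> mF Ff lg Fg.
have mf : measurable_fun setT f.
  by apply: (@measurable_fun_cvg _ _ _ setT F f) => // x _; exact: Ff.
have lf : L1 f.
  apply: (L1_dom mf lg) => x.
  have : (fun n => `|F n x|) @ \oo --> `|f x| by apply: cvg_norm; exact: Ff.
  move=> h; rewrite -(cvg_lim _ h)//; apply: limr_le; last exact: nearW.
  by apply/cvg_ex; eexists; exact: h.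
apply: fine_cvg; rewrite fineK; last exact: integrable_fin_num.
apply: (@dominated_cvg _ _ R mu setT measurableT (fun n => EFin \o F n) (EFin \o f) (EFin \o g)) => //.
- by move=> n; apply/measurable_EFinP; exact: mF.
- by move=> x _; apply: cvg_EFin; [exact: nearW|exact: Ff].
- by move=> n x _ /=; rewrite lee_fin.
Qed.

(** An integrand containing [|t|] has an elementary antiderivative on each half line only. Hence [G]
    belongs to a function [g] that agrees with [f] on the right half, and evenness supplies the left
    half. *)
Lemma even_segment_integral f g G n : continuous f -> continuous g ->
  (forall t, is_derive t 1 G (g t)) -> (forall t, 0 <= t -> f t = g t) ->
  (forall t, f (- t) = f t) ->
  \int[mu]_(x in `[- n%:R, n%:R]) f x = (G n%:R - G 0) *+ 2.
Proof.
move=> cf cg dG fg ef.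
have n0 : (0 : R) <= n%:R by [].
have n1 : - (n%:R : R) <= 0 by rewrite oppr_le0.
have i1 : mu.-integrable `[- n%:R, n%:R] (EFin \o f).
  by apply: continuous_compact_integrable; [exact: segment_compact|exact: continuous_subspaceT].
have := @Rintegral_itvB R f (BLeft (- n%:R)) (BRight n%:R) 0 i1.
rewrite !bnd_simp => /(_ n1 n0) /eqP; rewrite subr_eq => /eqP ->.
rewrite Rintegral_itv_obnd_cbnd; last first.
  apply: integrableS i1; rewrite //= => x /=; rewrite !in_itv/= => /andP[h ->].
  by rewrite andbT (le_trans n1)// ltW.
have -> : \int[mu]_(x in `[0, n%:R]) f x = G n%:R - G 0.
  transitivity (\int[mu]_(x in `[0, n%:R]) g x).
    by apply: eq_Rintegral => x; rewrite inE/= in_itv/= => /andP[x0 _]; exact: fg.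
  by rewrite /Rintegral (integral_segment_FTC n0 cg dG).
have -> : \int[mu]_(x in `[- n%:R, 0]) f x = G n%:R - G 0.
  transitivity (\int[mu]_(x in `[- n%:R, 0]) g (- x)).
    by apply: eq_Rintegral => x; rewrite inE/= in_itv/= => /andP[_ x0]; rewrite -fg ?ef// oppr_ge0.
  have dG' t : is_derive t 1 (fun t => - G (- t)) (g (- t)).
    have dN : is_derive t 1 (fun t : R => - t) (-1) by exact: is_deriveNid.
    apply: (is_derive_eq (is_deriveN (is_derive1_comp (dG (- t)) dN))).
    by rewrite mulrN1 opprK.
  rewrite /Rintegral (integral_segment_FTC n1 _ dG')/=.
    by rewrite oppr0 !opprK addrC.
  by move=> x; apply: continuous_comp; [exact: opp_continuous|exact: cg].
by rewrite mulr2n.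
Qed.

(** * Rules for derivatives and continuity of explicit real functions *)

Lemma is_derive1D f g (x df dg : R) : is_derive x 1 f df -> is_derive x 1 g dg ->
  is_derive x 1 (fun t => f t + g t) (df + dg).
Proof. exact: is_deriveD. Qed.

Lemma is_derive1N f (x df : R) : is_derive x 1 f df ->
  is_derive x 1 (fun t => - f t) (- df).
Proof. exact: is_deriveN. Qed.

Lemma is_derive1M f g (x df dg : R) : is_derive x 1 f df -> is_derive x 1 g dg ->
  is_derive x 1 (fun t => f t * g t) (df * g x + f x * dg).
Proof.
move=> hf hg; apply: (is_derive_eq (is_deriveM hf hg)).
by rewrite addrC /GRing.scale/=; congr (_ + _); rewrite mulrC.
Qed.

Lemma is_derive1Z c f (x df : R) : is_derive x 1 f df ->
  is_derive x 1 (fun t => c * f t) (c * df).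
Proof. exact: is_deriveZ. Qed.

Lemma is_derive1_lin c x : is_derive x 1 (fun t : R => c * t) c.
Proof. by apply: (is_derive_eq (is_derive1Z c (is_derive_id _ _))); rewrite mulr1. Qed.

Lemma is_derive1_exp f (x df : R) : is_derive x 1 f df ->
  is_derive x 1 (fun t => expR (f t)) (df * expR (f x)).
Proof. by move=> hf; apply: (is_derive_eq (is_derive1_comp (is_derive_expR _) hf)); rewrite mulrC. Qed.

Lemma is_derive1_cosf f (x df : R) : is_derive x 1 f df ->
  is_derive x 1 (fun t => cos (f t)) (- (df * sin (f x))).
Proof. by move=> hf; apply: (is_derive_eq (is_derive1_comp (is_derive_cos _) hf)); rewrite mulNr mulrC. Qed.

Lemma is_derive1_sinf f (x df : R) : is_derive x 1 f df ->
  is_derive x 1 (fun t => sin (f t)) (df * cos (f x)).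
Proof. by move=> hf; apply: (is_derive_eq (is_derive1_comp (is_derive_sin _) hf)); rewrite mulrC. Qed.

Lemma continuous_of_derive f (df : R -> R) :
  (forall x, is_derive x 1 f (df x)) -> continuous f.
Proof.
by move=> h x; apply: differentiable_continuous; apply/derivable1_diffP; case: (h x).
Qed.

Lemma continuous_mul f g : continuous f -> continuous g ->
  continuous (fun x => f x * g x).
Proof. by move=> cf cg x; apply: cvgM; [exact: cf|exact: cg]. Qed.

Lemma continuous_add f g : continuous f -> continuous g ->
  continuous (fun x => f x + g x).
Proof. by move=> cf cg x; apply: cvgD; [exact: cf|exact: cg]. Qed.

Lemma continuous_comp1 f g : continuous f -> continuous g ->
  continuous (fun x => f (g x)).
Proof. by move=> cf cg x; apply: continuous_comp; [exact: cg|exact: cf]. Qed.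

Lemma continuous_affine a b : continuous (fun x : R => a * x + b).
Proof.
apply: continuous_add; last by move=> x; exact: cvg_cst.
by apply: continuous_of_derive => x; exact: is_derive1_lin.
Qed.

Lemma continuous_lin a : continuous (fun x : R => a * x).
Proof. by apply: continuous_of_derive => x; exact: is_derive1_lin. Qed.

Lemma continuous_expabs e : continuous (fun t : R => expR (- e * `|t|)).
Proof.
apply: continuous_comp1; first exact: continuous_expR.
apply: (@continuous_comp1 (fun t => - e * t)); first exact: continuous_lin.
exact: norm_continuous.
Qed.

Lemma L1_expabs e : 0 < e -> L1 (fun t => expR (- e * `|t|)).
Proof.
move=> e0.
apply: (@integrable_exhaust _ _ _ (e^-1 *+ 2) measurableT (fun n => measurable_itv _) seg_nondecreasing bigcup_seg).
  by apply: continuous_measurable_fun; exact: continuous_expabs.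
move=> n.
have -> : (\int[mu]_(x in seg n) `|expR (- e * `|x|)|%:E = (\int[mu]_(x in seg n) expR (- e * `|x|))%:E)%E.
  rewrite /Rintegral fineK.
    by apply: eq_integral => x _; rewrite ger0_norm// expR_ge0.
  apply: integrable_fin_num => //; first exact: measurable_itv.
  apply: continuous_compact_integrable; first exact: segment_compact.
  by apply: continuous_subspaceT; exact: continuous_expabs.
pose G t := - (e^-1) * expR (- e * t).
have -> : \int[mu]_(x in seg n) expR (- e * `|x|) = (G n%:R - G 0) *+ 2.
  apply: (@even_segment_integral _ (fun t => expR (- e * t))).
  - exact: continuous_expabs.
  - by apply: continuous_comp1; [exact: continuous_expR|exact: continuous_lin].
  - move=> t; apply: (is_derive_eq (is_derive1Z (- e^-1) (is_derive1_exp (is_derive1_lin (- e) t)))).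
    by rewrite mulrA mulrNN mulVf ?mul1r// gt_eqF.
  - by move=> t t0; rewrite ger0_norm.
  - by move=> t; rewrite normrN.
rewrite lee_fin ler_pMn2r// /G mulr0 expR0 mulr1 opprK gerDr.
by rewrite mulNr oppr_le0 mulr_ge0 ?expR_ge0// invr_ge0 ltW.
Qed.

(** As a function of [b], the value is [2 pi] times the Poisson kernel of the half plane at height
    [e]. *)
Lemma Int_expabs_cos e b : 0 < e ->
  Int (fun t => expR (- e * `|t|) * cos (b * t)) = e *+ 2 / (e ^+ 2 + b ^+ 2).
Proof.
move=> e0.
have d0 : 0 < e ^+ 2 + b ^+ 2 by rewrite ltr_pwDl ?sqr_ge0// exprn_gt0.
have ccos : continuous (fun t => cos (b * t)).
  by apply: continuous_comp1; [exact: continuous_cos|exact: continuous_lin].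
have l1 : L1 (fun t => expR (- e * `|t|) * cos (b * t)).
  apply: (@L1_mul_bounded _ _ 1); first exact: L1_expabs.
    exact: continuous_measurable_fun.
  by move=> x; exact: cos_max.
have := cvg_Rintegral_exhaust measurableT (fun n => measurable_itv _) seg_nondecreasing bigcup_seg l1.
(* The real part of [exp ((- e + i b) t) / (- e + i b)]. *)
pose G t := (e ^+ 2 + b ^+ 2)^-1 * (expR (- e * t) * (b * sin (b * t) + (- e) * cos (b * t))).
have -> : (fun n => \int[mu]_(x in seg n) (expR (- e * `|x|) * cos (b * x))) = (fun n => (G n%:R - G 0) *+ 2).
  apply/funext => n; apply: (@even_segment_integral _ (fun t => expR (- e * t) * cos (b * t))).
  - by apply: continuous_mul => //; exact: continuous_expabs.
  - apply: continuous_mul => //.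
    by apply: continuous_comp1; [exact: continuous_expR|exact: continuous_lin].
  - move=> t; have lt c := is_derive1_lin c t.
    apply: (is_derive_eq (is_derive1Z (e ^+ 2 + b ^+ 2)^-1 (is_derive1M (is_derive1_exp (lt (- e))) (is_derive1D (is_derive1Z b (is_derive1_sinf (lt b))) (is_derive1Z (- e) (is_derive1_cosf (lt b))))))).
    by field; rewrite gt_eqF.
  - by move=> t t0; rewrite ger0_norm.
  - by move=> t; rewrite normrN mulrN cosN.
have H : (fun n => (G n%:R - G 0) *+ 2) @ \oo --> (0 - G 0) *+ 2.
  apply: cvgMn; apply: cvgB; last exact: cvg_cst.
  rewrite /G -(mulr0 (e ^+ 2 + b ^+ 2)^-1); apply: cvgM; first exact: cvg_cst.
  have E0 : (fun n => expR (- e * n%:R) * (`|b| + e)) @ \oo --> (0 : R).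
    rewrite -(mul0r (`|b| + e)); apply: cvgM; last exact: cvg_cst.
    have q : `|expR (- e)| < 1 by rewrite ger0_norm ?expR_ge0// expR_lt1 oppr_lt0.
    rewrite (_ : (fun n => _) = (fun n => expR (- e) ^+ n)); first exact: cvg_expr q.
    by apply/funext => n; rewrite expRM_natr.
  apply/norm_cvg0P; apply: (@squeeze_cvgr _ _ _ _ (cst 0) (fun n => expR (- e * n%:R) * (`|b| + e))) => //; last exact: cvg_cst.
  apply: nearW => n; rewrite /= normr_ge0/= normrM ger0_norm ?expR_ge0// ler_wpM2l ?expR_ge0//.
  apply: (le_trans (ler_normD _ _)); rewrite !normrM normrN (gtr0_norm e0).
  by apply: lerD; rewrite ler_piMr ?sin_max ?cos_max ?normr_ge0// ltW.
move=> /(cvg_unique _ H) <- //.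
rewrite /G mulr0 expR0 mulr0 sin0 cos0 mulr0 add0r mul1r mulr1 sub0r.
by field; rewrite gt_eqF.
Qed.

Lemma L1_cauchy : L1 (fun v : R => (1 + v ^+ 2)^-1).
Proof.
apply: (@L1_FTC atan _ (pi / 2)).
- exact: continuous_oneDsqrV.
- by move=> x; rewrite invr_ge0 addr_ge0// sqr_ge0.
- by move=> x; rewrite ler_norml (ltW (atan_gtNpi2 _)) (ltW (atan_ltpi2 _)).
Qed.

Lemma Int_cauchy : Int (fun v : R => (1 + v ^+ 2)^-1) = pi.
Proof.
apply: (@Int_FTC atan).
- exact: continuous_oneDsqrV.
- exact: L1_cauchy.
- have -> : (fun n => atan (n%:R : R) - atan (- n%:R)) = (fun n => atan (n%:R : R) *+ 2).
    by apply/funext => n; rewrite atanN opprK mulr2n.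
  have -> : pi = (pi / 2 : R) *+ 2 by rewrite mulr2n -splitr.
  apply: cvgMn; apply: (@cvg_comp _ _ _ (fun n : nat => n%:R : R) atan _ (+oo%R)); last exact: cvgy_atan.
  exact: cvgr_idn.
Qed.

(** * Fourier inversion *)

Lemma continuous_cos_shift t x : continuous (fun y : R => cos (t * (y - x))).
Proof.
apply: continuous_comp1; first exact: continuous_cos.
apply: (@continuous_comp1 (fun y => t * y)); first exact: continuous_lin.
by move=> y; apply: cvgB; [exact: cvg_id|exact: cvg_cst].
Qed.

(** Exchanging the integrals turns the Abel mean of the inversion integral into [f] integrated
    against the kernel of [Int_expabs_cos]. The substitution [y = e v + x] then moves [e] from the
    kernel into the argument of [f], where continuity can be used as [e] tends to 0. *)
Lemma abel_poisson f e x : 0 < e -> L1 f ->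
  Int (fun t => expR (- e * `|t|) * Int (fun y => f y * cos (t * (y - x)))) =
  Int (fun v => f (e * v + x) * (2 / (1 + v ^+ 2))).
Proof.
move=> e0 lf; have mf := L1_measurable lf.
pose F t y := expR (- e * `|t|) * (f y * cos (t * (y - x))).
have l1 t : L1 (F t).
  apply: L1Z; apply: (@L1_mul_bounded _ _ 1) => //; last by move=> y; exact: cos_max.
  by apply: continuous_measurable_fun; exact: continuous_cos_shift.
have l2 y : L1 (F ^~ y).
  rewrite (_ : EFin \o _ = EFin \o (fun t => f y * (expR (- e * `|t|) * cos ((y - x) * t)))); last first.
    by apply/funext => t; rewrite /F /= mulrCA (mulrC t).
  apply: L1Z; apply: (@L1_mul_bounded _ _ 1) => //; [exact: L1_expabs| |by move=> t; exact: cos_max].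
  apply: continuous_measurable_fun.
  by apply: continuous_comp1; [exact: continuous_cos|exact: continuous_lin].
have mF : measurable_fun setT (fun z : R * R => F z.1 z.2).
  apply: measurable_funM.
    apply: (@measurableT_comp _ _ _ _ _ _ (fun t => expR (- e * `|t|)) _ fst) => //.
    by apply: continuous_measurable_fun; exact: continuous_expabs.
  apply: measurable_funM.
    exact: (@measurableT_comp _ _ _ _ _ _ f _ snd).
  apply: (@measurableT_comp _ _ _ _ _ _ cos).
    by apply: continuous_measurable_fun; exact: continuous_cos.
  by apply: measurable_funM => //; exact: measurable_funB.
have bF y : Int (fun t => `|F t y|) <= Int (fun t => expR (- e * `|t|)) * `|f y|.
  rewrite mulrC -IntZ; last exact: L1_expabs.
  apply: le_Int; [exact: L1_norm|by apply: L1Z; exact: L1_expabs|].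
  move=> t; rewrite /F !normrM (ger0_norm (expR_ge0 _)) mulrCA ler_wpM2l//.
  by rewrite ler_piMr ?expR_ge0// cos_max.
have [_ _ FF] := Fubini_L1 mF l1 l2 (L1Z _ (L1_norm lf)) bF.
clear mF l2 bF.
transitivity (Int (fun t => Int (F t))).
  apply: eq_Rintegral => t _; clear FF; rewrite /F IntZ//.
  apply: (@L1_mul_bounded _ _ 1) => //; last by move=> y; exact: cos_max.
  by apply: continuous_measurable_fun; exact: continuous_cos_shift.
rewrite {}FF; clear l1.
pose H y := f y * (e *+ 2 / (e ^+ 2 + (y - x) ^+ 2)).
transitivity (Int H).
  apply: eq_Rintegral => y _; rewrite /H -Int_expabs_cos//.
  rewrite -IntZ.
    by apply: eq_Rintegral => t _; rewrite /F mulrCA (mulrC t).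
  apply: (@L1_mul_bounded _ _ 1) => //; [exact: L1_expabs| |by move=> t; exact: cos_max].
  apply: continuous_measurable_fun.
  by apply: continuous_comp1; [exact: continuous_cos|exact: continuous_lin].
have ne0 : e != 0 by rewrite gt_eqF.
have lH : L1 H.
  have d0 (y : R) : 0 < e ^+ 2 + (y - x) ^+ 2 by rewrite ltr_pwDl ?sqr_ge0// exprn_gt0.
  (* The kernel is largest at [y = x], with value [2 / e]. *)
  apply: (@L1_mul_bounded _ _ (2 / e)) => //.
    apply: continuous_measurable_fun => y.
    apply: cvgM; first exact: cvg_cst.
    apply: cvgV; first by rewrite gt_eqF.
    apply: cvgD; first exact: cvg_cst.
    apply: (@continuous_comp1 (fun z => z ^+ 2) (fun z => z - x)); first exact: exprn_continuous.
    by move=> z; apply: cvgB; [exact: cvg_id|exact: cvg_cst].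
  move=> y; rewrite ger0_norm; last by rewrite divr_ge0 ?mulrn_wge0 ?ltW.
  rewrite ler_pdivrMr//.
  have -> : 2 / e * (e ^+ 2 + (y - x) ^+ 2) = e *+ 2 + 2 / e * (y - x) ^+ 2 by field.
  by rewrite lerDl mulr_ge0 ?sqr_ge0// divr_ge0// ltW.
have -> : Int H = `|e| * Int (fun v => H (e * v + x)).
  by rewrite Int_affine// mulrA divff ?mul1r// normr_eq0.
rewrite -IntZ; last exact: L1_affine.
apply: eq_Rintegral => v _; rewrite /H addrK gtr0_norm// exprMn.
have d1 : 1 + v ^+ 2 != 0 by rewrite gt_eqF// ltr_pwDl ?sqr_ge0.
have d2 : e ^+ 2 + e ^+ 2 * v ^+ 2 != 0.
  by rewrite -[X in X + _]mulr1 -mulrDr mulf_neq0// expf_neq0.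
by rewrite mulrCA; congr (_ * _); field; rewrite d1/= exprMn.
Qed.

Lemma continuous_cvg_seq f (u : nat -> R) (l : R) : continuous f -> u @ \oo --> l ->
  (fun n => f (u n)) @ \oo --> f l.
Proof. by move=> cf ul; apply: (cvg_comp _ _ ul); exact: cf. Qed.

(** Both sides of [abel_poisson] converge as [e] tends to 0: the left one is dominated by the
    transform itself, assumed integrable, and the right one by [B] times a Cauchy density. The
    factor [2 pi] is twice [Int_cauchy]. *)
Lemma fourier_inversion f (B : R) x : continuous f -> L1 f -> (forall y, `|f y| <= B) ->
  L1 (fun t => Int (fun y => f y * cos (t * (y - x)))) ->
  Int (fun t => Int (fun y => f y * cos (t * (y - x)))) = pi *+ 2 * f x.
Proof.
move=> cf lf fB lC; set C := fun t => _ in lC *.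
pose e (n : nat) : R := n.+1%:R^-1.
have e0 n : 0 < e n by rewrite invr_gt0.
have ecv : e @ \oo --> (0 : R) by exact: cvg_harmonic.
have cv1 : (fun n => Int (fun t => expR (- e n * `|t|) * C t)) @ \oo --> Int C.
  apply: (@Int_dominated_cvg _ _ (fun t => `|C t|)) => //.
  - move=> n; apply: measurable_funM; last exact: L1_measurable.
    by apply: continuous_measurable_fun; exact: continuous_expabs.
  - move=> t; rewrite -[X in _ --> X]mul1r; apply: cvgM; last exact: cvg_cst.
    suff : (fun n => expR (- e n * `|t|)) @ \oo --> expR (0 : R) by rewrite expR0.
    apply: continuous_cvg_seq; first exact: continuous_expR.
    rewrite -(mul0r `|t|) -oppr0; apply: cvgM; last exact: cvg_cst.
    exact: cvgN.
  - exact: L1_norm.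
  - move=> n t; rewrite normrM ger0_norm ?expR_ge0// ler_piMl// expR_le1.
    by rewrite mulNr oppr_le0 mulr_ge0// ltW.
have cv2 : (fun n => Int (fun v => f (e n * v + x) * (2 / (1 + v ^+ 2)))) @ \oo -->
    Int (fun v => f x * (2 / (1 + v ^+ 2))).
  have d0 (v : R) : 0 < 1 + v ^+ 2 by rewrite ltr_pwDl ?sqr_ge0.
  have ck : continuous (fun v : R => 2 / (1 + v ^+ 2)).
    by move=> v; apply: cvgM; [exact: cvg_cst|exact: continuous_oneDsqrV].
  apply: (@Int_dominated_cvg _ _ (fun v => B * 2 * (1 + v ^+ 2)^-1)).
  - move=> n; apply: continuous_measurable_fun; apply: continuous_mul => //.
    by apply: continuous_comp1 => //; exact: continuous_affine.
  - move=> v; apply: cvgM; last exact: cvg_cst.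
    apply: continuous_cvg_seq; first exact: cf.
    rewrite -[X in _ --> X]add0r -(mul0r v); apply: cvgD; last exact: cvg_cst.
    by apply: cvgM; [exact: ecv|exact: cvg_cst].
  - exact/L1Z/L1_cauchy.
  - move=> n v; rewrite normrM -mulrA ler_pM// ger0_norm//.
    by rewrite divr_ge0// ltW.
have EQ : (fun n => Int (fun t => expR (- e n * `|t|) * C t)) = (fun n => Int (fun v => f (e n * v + x) * (2 / (1 + v ^+ 2)))).
  by apply/funext => n; exact: abel_poisson.
rewrite EQ in cv1; rewrite (cvg_unique _ cv1 cv2)//.
transitivity (Int (fun v => (f x * 2) * (1 + v ^+ 2)^-1)).
  by apply: eq_Rintegral => v _; rewrite mulrA.
by rewrite IntZ; [rewrite Int_cauchy -mulr_natl; ring|exact: L1_cauchy].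
Qed.

(** * Complex-valued integrals and the Fourier transform *)

Notation Re := (@complex.Re R).
Notation Im := (@complex.Im R).
Notation CL1 f := (cintegrable setT f).
Notation CInt f := (cintegral setT f).
Implicit Types (z : R[i]) (u v : R -> R[i]).

Lemma ReM z (w : R[i]) : Re (z * w) = Re z * Re w - Im z * Im w.
Proof. by case: z; case: w. Qed.

Lemma ImM z (w : R[i]) : Im (z * w) = Re z * Im w + Im z * Re w.
Proof. by case: z; case: w. Qed.

Lemma complex_ext z (w : R[i]) : Re z = Re w -> Im z = Im w -> z = w.
Proof. by case: z; case: w => a b c d /= -> ->. Qed.

Lemma ReCInt u : Re (CInt u) = Int (fun x => Re (u x)). Proof. by []. Qed.

Lemma ImCInt u : Im (CInt u) = Int (fun x => Im (u x)). Proof. by []. Qed.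

Definition cis t : R[i] := cos t +i* sin t.

Lemma cisD x y : cis (x + y) = cis x * cis y.
Proof.
apply: complex_ext; rewrite ?ReM ?ImM /=; first by rewrite cosD.
by rewrite sinD addrC.
Qed.

Lemma cis0 : cis 0 = 1.
Proof. by rewrite /cis cos0 sin0. Qed.

Lemma CL1Z (k : R[i]) u : CL1 u -> CL1 (fun x => k * u x).
Proof.
move=> [u1 u2]; split.
  rewrite (_ : EFin \o _ = EFin \o (fun x => Re k * Re (u x) - Im k * Im (u x))).
    by apply: L1B; exact: L1Z.
  by apply/funext => x /=; rewrite ReM.
rewrite (_ : EFin \o _ = EFin \o (fun x => Re k * Im (u x) + Im k * Re (u x))).
  by apply: L1D; exact: L1Z.
by apply/funext => x /=; rewrite ImM.
Qed.

Lemma CIntZ (k : R[i]) u : CL1 u -> CInt (fun x => k * u x) = k * CInt u.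
Proof.
move=> [u1 u2]; apply: complex_ext.
  rewrite ReM /= -!IntZ// -IntB; [|exact: L1Z|exact: L1Z].
  by apply: eq_Rintegral => x _; rewrite ReM.
rewrite ImM /= -!IntZ// -IntD; [|exact: L1Z|exact: L1Z].
by apply: eq_Rintegral => x _; rewrite ImM.
Qed.

Lemma CL1_real f : L1 f -> CL1 (fun x => (f x)%:C).
Proof.
move=> lf; split => //.
rewrite (_ : EFin \o _ = EFin \o (fun x => 0 * f x)); first exact: L1Z.
by apply/funext => x /=; rewrite mul0r.
Qed.

Lemma CInt_real f : CInt (fun x => (f x)%:C) = (Int f)%:C.
Proof. by apply: complex_ext => //=; rewrite /Rintegral integral0. Qed.

Lemma CL1_mul_bounded u v M : CL1 u ->
  measurable_fun setT (Re \o v) -> measurable_fun setT (Im \o v) ->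
  (forall x, `|Re (v x)| <= M) -> (forall x, `|Im (v x)| <= M) ->
  CL1 (fun x => u x * v x).
Proof.
move=> [u1 u2] m1 m2 v1 v2; split.
  rewrite (_ : EFin \o _ = EFin \o (fun x => Re (u x) * Re (v x) - Im (u x) * Im (v x))).
    by apply: L1B; exact: L1_mul_bounded.
  by apply/funext => x /=; rewrite ReM.
rewrite (_ : EFin \o _ = EFin \o (fun x => Re (u x) * Im (v x) + Im (u x) * Re (v x))).
  by apply: L1D; exact: L1_mul_bounded.
by apply/funext => x /=; rewrite ImM.
Qed.

Lemma continuous_coslin t : continuous (fun x : R => cos (t * x)).
Proof. by apply: continuous_comp1; [exact: continuous_cos|exact: continuous_lin]. Qed.

Lemma continuous_sinlin t : continuous (fun x : R => sin (t * x)).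
Proof. by apply: continuous_comp1; [exact: continuous_sin|exact: continuous_lin]. Qed.

Lemma CL1_cis u t : CL1 u -> CL1 (fun x => u x * cis (t * x)).
Proof.
move=> lu; apply: (@CL1_mul_bounded _ _ 1) => //.
- by apply: continuous_measurable_fun; exact: continuous_coslin.
- by apply: continuous_measurable_fun; exact: continuous_sinlin.
- by move=> x; exact: cos_max.
- by move=> x; exact: sin_max.
Qed.

Lemma CInt_shift u y : CL1 u -> CInt (fun x => u (x - y)) = CInt u.
Proof.
by move=> [u1 u2]; apply: complex_ext; rewrite /=; [exact: (Int_shift y u1)|exact: (Int_shift y u2)].
Qed.

Lemma CL1_shift u y : CL1 u -> CL1 (fun x => u (x - y)).
Proof.
by move=> [u1 u2]; split; [exact: (L1_shift y u1)|exact: (L1_shift y u2)].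
Qed.

Lemma CFubini (F : R -> R -> R[i]) (b : R -> R -> R) (m : R -> R) :
  measurable_fun setT (fun p : R * R => Re (F p.1 p.2)) ->
  measurable_fun setT (fun p : R * R => Im (F p.1 p.2)) ->
  (forall x, CL1 (F x)) -> (forall y, CL1 (F ^~ y)) -> L1 m ->
  (forall x y, `|Re (F x y)| <= b x y) -> (forall x y, `|Im (F x y)| <= b x y) ->
  (forall y, L1 (b ^~ y)) -> (forall y, Int (b ^~ y) <= m y) ->
  [/\ CL1 (fun x => CInt (F x)), CL1 (fun y => CInt (F ^~ y)) &
  CInt (fun x => CInt (F x)) = CInt (fun y => CInt (F ^~ y))].
Proof.
move=> m1 m2 s1 s2 lm b1 b2 lb bm.
have B1 y : Int (fun x => `|Re (F x y)|) <= m y.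
  by apply: le_trans (bm y); apply: le_Int => //; apply: L1_norm; case: (s2 y).
have B2 y : Int (fun x => `|Im (F x y)|) <= m y.
  by apply: le_trans (bm y); apply: le_Int => //; apply: L1_norm; case: (s2 y).
have [p1 p2 p3] := Fubini_L1 m1 (fun x => (s1 x).1) (fun y => (s2 y).1) lm B1.
have [q1 q2 q3] := Fubini_L1 m2 (fun x => (s1 x).2) (fun y => (s2 y).2) lm B2.
by split; [split; [exact: p1|exact: q1]|split; [exact: p2|exact: q2]|apply: complex_ext; [exact: p3|exact: q3]].
Qed.

Lemma measurable_compF f (g : R * R -> R) : measurable_fun setT f ->
  measurable_fun setT g -> measurable_fun setT (fun p => f (g p)).
Proof. exact: measurableT_comp. Qed.

Lemma continuous_Int_param f (h : R -> R -> R) : L1 f ->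
  (forall t x, `|h t x| <= 1) -> (forall t, continuous (h t)) ->
  (forall x, continuous (h ^~ x)) ->
  continuous (fun t => Int (fun x => f x * h t x)).
Proof.
move=> lf h1 c1 c2 t.
have H := @continuity_under_integral R _ (measurableTypeR R) mu (fun t x => f x * h t x) setT measurableT (t - 1) (t + 1).
apply: (H _ _ (fun x => `|f x|)).
- move=> s _; apply: (@L1_mul_bounded _ _ 1) => //.
  exact: continuous_measurable_fun.
- apply: aeW => x _ s _; apply: cvgM; [exact: cvg_cst|exact: c2].
- exact: L1_norm.
- by move=> s _; apply: aeW => x _; rewrite normrM ler_piMr.
- by rewrite inE/= in_itv/= ltrBlDr ltrDl ltr01.
Qed.

(** The exponent has a plus sign, so that for [f x = exp (c x) h x] this is the Mellin transform of
    [h (ln u)] at [c + i t]. *)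
Definition hat f t : R[i] := CInt (fun x => (f x)%:C * cis (t * x)).

Lemma hatE f t : hat f t =
  (Int (fun x => f x * cos (t * x))) +i* (Int (fun x => f x * sin (t * x))).
Proof.
apply: complex_ext; rewrite /=; apply: eq_Rintegral => x _;
  by rewrite ?ReM ?ImM/= mul0r ?subr0 ?addr0.
Qed.

Lemma L1_cos f t : L1 f -> L1 (fun x => f x * cos (t * x)).
Proof.
move=> lf; apply: (@L1_mul_bounded _ _ 1) => //; last by move=> x; exact: cos_max.
by apply: continuous_measurable_fun; exact: continuous_coslin.
Qed.

Lemma L1_sin f t : L1 f -> L1 (fun x => f x * sin (t * x)).
Proof.
move=> lf; apply: (@L1_mul_bounded _ _ 1) => //; last by move=> x; exact: sin_max.
by apply: continuous_measurable_fun; exact: continuous_sinlin.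
Qed.

Lemma continuous_Int_cos f : L1 f -> continuous (fun t => Int (fun x => f x * cos (t * x))).
Proof.
move=> lf; apply: (continuous_Int_param (h := fun t x => cos (t * x))) => //.
- by move=> t x; exact: cos_max.
- by move=> t; exact: continuous_coslin.
- by move=> x; under eq_fun do rewrite mulrC; exact: continuous_coslin.
Qed.

Lemma continuous_Int_sin f : L1 f -> continuous (fun t => Int (fun x => f x * sin (t * x))).
Proof.
move=> lf; apply: (continuous_Int_param (h := fun t x => sin (t * x))) => //.
- by move=> t x; exact: sin_max.
- by move=> t; exact: continuous_sinlin.
- by move=> x; under eq_fun do rewrite mulrC; exact: continuous_sinlin.
Qed.

Lemma hat_continuous f : L1 f -> continuous (Re \o hat f) /\ continuous (Im \o hat f).
Proof.
move=> lf; split.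
  rewrite (_ : Re \o hat f = (fun t => Int (fun x => f x * cos (t * x)))); first exact: continuous_Int_cos.
  by apply/funext => t; rewrite /comp hatE.
rewrite (_ : Im \o hat f = (fun t => Int (fun x => f x * sin (t * x)))); first exact: continuous_Int_sin.
by apply/funext => t; rewrite /comp hatE.
Qed.

Lemma hat_bounded f t : L1 f ->
  `|Re (hat f t)| <= Int (fun x => `|f x|) /\ `|Im (hat f t)| <= Int (fun x => `|f x|).
Proof.
move=> lf; rewrite hatE /=; split; apply: normr_Int_le.
- exact: L1_cos.
- exact: L1_norm.
- by move=> x; rewrite normrM ler_piMr// cos_max.
- exact: L1_sin.
- exact: L1_norm.
- by move=> x; rewrite normrM ler_piMr// sin_max.
Qed.

Lemma Int_odd f : L1 f -> (forall t, f (- t) = - f t) -> Int f = 0.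
Proof.
move=> lf of_.
have := Int_reflect 0 lf.
have -> : Int (fun x => f (0 - x)) = Int (fun t => -1 * f t).
  by apply: eq_Rintegral => t _; rewrite sub0r of_ mulN1r.
by rewrite IntZ// mulN1r; lra.
Qed.

Lemma L1Zr c f : L1 f -> L1 (fun x => f x * c).
Proof. by under eq_fun do rewrite mulrC; exact: L1Z. Qed.

(** The real part is [fourier_inversion]. Since [f] is real, the imaginary part of the integrand is
    odd in [t] and integrates to 0. *)
Lemma hat_inversion f (B : R) x : continuous f -> L1 f -> (forall y, `|f y| <= B) ->
  CL1 (hat f) ->
  CInt (fun t => hat f t * cis (- x * t)) = (pi *+ 2 * f x)%:C.
Proof.
move=> cf lf fB lh.
have [l1 l2] := CL1_cis (- x) lh.
have E1 t : Re (hat f t * cis (- x * t)) = Int (fun y => f y * cos (t * (y - x))).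
  rewrite ReM hatE /= mulNr cosN sinN mulrN opprK -!IntZr; [|exact: L1_sin|exact: L1_cos].
  have q1 := L1_cos t lf; have q2 := L1_sin t lf.
  rewrite -IntD.
  - by apply: eq_Rintegral => y _; rewrite mulrBr cosB (mulrC x t); ring.
  - exact: L1Zr.
  - exact: L1Zr.
apply: complex_ext; rewrite ?ReCInt ?ImCInt.
  rewrite [RHS]/= -(fourier_inversion cf lf fB).
    by apply: eq_Rintegral => t _; exact: E1.
  rewrite (_ : EFin \o _ = EFin \o (fun t => Re (hat f t * cis (- x * t))))//.
  by apply/funext => t; rewrite /comp E1.
apply: Int_odd => // t.
rewrite !ImM !hatE /= !mulrN !cosN !sinN.
have -> : Int (fun y => f y * cos (- t * y)) = Int (fun y => f y * cos (t * y)).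
  by apply: eq_Rintegral => y _; rewrite mulNr cosN.
have -> : Int (fun y => f y * sin (- t * y)) = Int (fun y => -1 * (f y * sin (t * y))).
  by apply: eq_Rintegral => y _; rewrite mulN1r -mulrN -sinN mulNr.
by rewrite IntZ; [ring|exact: L1_sin].
Qed.

(** * Convolution *)

Definition conv f (h : R -> R) x := Int (fun y => f y * h (x - y)).

Lemma measurable_conv_kernel f (h : R -> R) : measurable_fun setT f -> measurable_fun setT h ->
  measurable_fun setT (fun p : R * R => f p.2 * h (p.1 - p.2)).
Proof.
move=> mf mh; apply: measurable_funM; first exact: (@measurable_compF f snd).
by apply: (@measurable_compF h (fun p => p.1 - p.2)) => //; exact: measurable_funB.
Qed.

Lemma measurable_reflect (h : R -> R) x : measurable_fun setT h -> measurable_fun setT (fun y => h (x - y)).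
Proof.
move=> mh; apply: (@measurableT_comp _ _ _ _ _ _ h _ (fun y => x - y)) => //.
exact: measurable_funB.
Qed.

Lemma L1_conv_kernel f (h : R -> R) (B : R) x : L1 f -> measurable_fun setT h ->
  (forall y, `|h y| <= B) -> L1 (fun y => f y * h (x - y)).
Proof.
by move=> lf mh hB; apply: (L1_mul_bounded lf (measurable_reflect x mh)) => y; exact: hB.
Qed.

(** The bound on [h] makes the convolution integral converge at every [x], as [Fubini_L1]
    requires. *)
Lemma conv_L1 f (h : R -> R) (B : R) : L1 f -> L1 h -> (forall y, `|h y| <= B) -> L1 (conv f h).
Proof.
move=> lf lh hB; have mf := L1_measurable lf; have mh := L1_measurable lh.
have [] // := @Fubini_L1 (fun x y => f y * h (x - y)) (fun y => Int (fun x => `|h x|) * `|f y|).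
- exact: measurable_conv_kernel.
- by move=> x; exact: L1_conv_kernel hB.
- by move=> y; apply: L1Z; exact: L1_shift.
- by apply: L1Z; exact: L1_norm.
- move=> y; rewrite -(Int_shift y (L1_norm lh)) mulrC -IntZ; last by have := L1_shift y (L1_norm lh).
  apply: le_Int => //.
  + by apply: L1_norm; apply: L1Z; exact: L1_shift.
  + by apply: L1Z; exact: (L1_shift y (L1_norm lh)).
  + by move=> x; rewrite normrM.
Qed.

Lemma conv_hat f (h : R -> R) (B : R) t : L1 f -> L1 h -> (forall y, `|h y| <= B) ->
  hat (conv f h) t = hat f t * hat h t.
Proof.
move=> lf lh hB; have mf := L1_measurable lf; have mh := L1_measurable lh.
pose F x y := (f y * h (x - y))%:C * cis (t * x).
have sx x : CL1 (F x).
  rewrite (_ : F x = fun y => cis (t * x) * (f y * h (x - y))%:C).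
    by apply: CL1Z; apply: CL1_real; exact: L1_conv_kernel hB.
  by apply/funext => y; rewrite mulrC.
have FE y : F ^~ y = fun x => ((f y)%:C * cis (t * y)) * ((h (x - y))%:C * cis (t * (x - y))).
  apply/funext => x; rewrite /F mulrACA -cisD rmorphM; congr (_ * cis _); ring.
have sy y : CL1 (F ^~ y).
  rewrite FE; apply: CL1Z; apply: (@CL1_shift (fun x => (h x)%:C * cis (t * x))).
  by apply: CL1_cis; exact: CL1_real.
have mk := measurable_conv_kernel mf mh.
have mt g : continuous g -> measurable_fun setT (fun p : R * R => g (t * p.1)).
  move=> cg; apply: (@measurable_compF g (fun p => t * p.1)); first exact: continuous_measurable_fun.
  exact: measurable_funM.
have [|||||||_ _ FF] := @CFubini F (fun x y => `|f y| * `|h (x - y)|) (fun y => Int (fun x => `|h x|) * `|f y|) _ _ sx sy.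
- rewrite (_ : (fun p => _) = (fun p => (f p.2 * h (p.1 - p.2)) * cos (t * p.1))).
    by apply: measurable_funM => //; apply: mt; exact: continuous_cos.
  by apply/funext => p; rewrite ReM /= mul0r subr0.
- rewrite (_ : (fun p => _) = (fun p => (f p.2 * h (p.1 - p.2)) * sin (t * p.1))).
    by apply: measurable_funM => //; apply: mt; exact: continuous_sin.
  by apply/funext => p; rewrite ImM /= mul0r addr0.
- by apply: L1Z; exact: L1_norm.
- by move=> x y; rewrite ReM /= mul0r subr0 [leLHS]normrM -[leRHS]normrM ler_piMr// cos_max.
- by move=> x y; rewrite ImM /= mul0r addr0 [leLHS]normrM -[leRHS]normrM ler_piMr// sin_max.
- by move=> y; apply: L1Z; exact: (L1_shift y (L1_norm lh)).
- move=> y; rewrite -(Int_shift y (L1_norm lh)) mulrC -IntZ//.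
  exact: (L1_shift y (L1_norm lh)).
transitivity (CInt (fun x => CInt (F x))).
  rewrite /hat; congr (CInt _); apply/funext => x.
  rewrite -CInt_real mulrC -CIntZ; last by apply: CL1_real; exact: L1_conv_kernel hB.
  by congr (CInt _); apply/funext => y; rewrite /F mulrC.
rewrite {}FF; transitivity (CInt (fun y => hat h t * ((f y)%:C * cis (t * y)))).
  congr (CInt _); apply/funext => y; rewrite FE CIntZ.
    rewrite (@CInt_shift (fun x => (h x)%:C * cis (t * x))); first exact: mulrC.
    by apply: CL1_cis; exact: CL1_real.
  apply: (@CL1_shift (fun x => (h x)%:C * cis (t * x))).
  by apply: CL1_cis; exact: CL1_real.
rewrite CIntZ; first exact: mulrC.
by apply: CL1_cis; exact: CL1_real.
Qed.

Lemma CInt_inv_bound (P : R -> R[i]) (a : R) t : CL1 P ->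
  `|Re (CInt (fun t => P t * cis (a * t)))| <= Int (fun t => `|Re (P t)| + `|Im (P t)|).
Proof.
move=> lP; have [l1 l2] := lP; have [q1 _] := CL1_cis a lP.
apply: normr_Int_le => //; first by apply: L1D; exact: L1_norm.
move=> x; rewrite ReM /=; apply: (le_trans (ler_normB _ _)).
by rewrite !normrM lerD// ler_piMr// ?cos_max ?sin_max.
Qed.

(** The inversion formula expresses [h] by cosine and sine integrals of integrable functions.
    Continuity, and boundedness in [inversion_bounded], are thus consequences of inversion and need
    not be carried through the convolutions. *)
Lemma inversion_continuous (P : R -> R[i]) (h : R -> R) : CL1 P ->
  (forall x, CInt (fun t => P t * cis (- x * t)) = (pi *+ 2 * h x)%:C) -> continuous h.
Proof.
move=> [l1 l2] H.
have pi2 : pi *+ 2 != 0 :> R by rewrite mulrn_eq0/= gt_eqF// pi_gt0.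
pose k x := Int (fun t => Re (P t) * cos (x * t)) + Int (fun t => Im (P t) * sin (x * t)).
have -> : h = (fun x => (pi *+ 2)^-1 * k x).
  apply/funext => x; apply: (mulfI pi2); rewrite mulrA divff// mul1r.
  have := congr1 (@complex.Re R) (H x); rewrite [RHS]/= => <-.
  rewrite ReCInt /k -IntD; [|exact: L1_cos|exact: L1_sin].
  by apply: eq_Rintegral => t _; rewrite ReM /= mulNr cosN sinN mulrN opprK.
apply: continuous_mul; first by move=> ?; exact: cvg_cst.
apply: continuous_add; [exact: continuous_Int_cos|exact: continuous_Int_sin].
Qed.

Lemma inversion_bounded (P : R -> R[i]) (h : R -> R) : CL1 P ->
  (forall x, CInt (fun t => P t * cis (- x * t)) = (pi *+ 2 * h x)%:C) ->
  exists B : R, forall x, `|h x| <= B.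
Proof.
move=> lP Hh; exists ((pi *+ 2)^-1 * Int (fun t => `|Re (P t)| + `|Im (P t)|)) => y.
have pi2 : 0 < pi *+ 2 :> R by rewrite mulrn_wgt0 ?pi_gt0.
rewrite mulrC ler_pdivlMr// mulrC -{1}(gtr0_norm pi2) -normrM.
by have := CInt_inv_bound (- y) y lP; rewrite Hh.
Qed.

(** The formula for [conv f h] is deduced from the one for [h]: once [hat f] is expanded, the phases
    combine into [cis (- (x - y) * t)], and after Fubini the inner integral is the inversion of [h]
    at [x - y]. *)
Lemma conv_inversion (P : R -> R[i]) f (h : R -> R) x : CL1 P -> L1 f ->
  (forall y, CInt (fun t => P t * cis (- y * t)) = (pi *+ 2 * h y)%:C) ->
  CInt (fun t => (P t * hat f t) * cis (- x * t)) = (pi *+ 2 * conv f h x)%:C.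
Proof.
move=> lP lf Hh; have [l1 l2] := lP; have mf := L1_measurable lf.
have ch := inversion_continuous lP Hh.
have [B hB] := inversion_bounded lP Hh.
pose F t y := P t * cis (- x * t) * ((f y)%:C * cis (t * y)).
have sx t : CL1 (F t).
  by apply: CL1Z; apply: CL1_cis; exact: CL1_real.
have FEt t y : F t y = (f y)%:C * (P t * cis (- (x - y) * t)).
  rewrite /F mulrACA -mulrA mulrCA -cisD; congr (_ * (_ * cis _)); ring.
have FE y : F ^~ y = fun t => (f y)%:C * (P t * cis (- (x - y) * t)).
  by apply/funext => t; exact: FEt.
have sy y : CL1 (F ^~ y).
  by rewrite FE; apply: CL1Z; exact: CL1_cis.
pose b t : R := `|Re (P t)| + `|Im (P t)|.
have lb : L1 b by apply: L1D; exact: L1_norm.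
have mP1 : measurable_fun setT (fun p : R * R => Re (P p.1)).
  by apply: (@measurable_compF (fun t => Re (P t)) fst) => //; exact: L1_measurable.
have mP2 : measurable_fun setT (fun p : R * R => Im (P p.1)).
  by apply: (@measurable_compF (fun t => Im (P t)) fst) => //; exact: L1_measurable.
have mf2 : measurable_fun setT (fun p : R * R => f p.2) by exact: (@measurable_compF f snd).
have mt g : continuous g -> measurable_fun setT (fun p : R * R => g (- (x - p.2) * p.1)).
  move=> cg; apply: (@measurable_compF g (fun p => - (x - p.2) * p.1)); first exact: continuous_measurable_fun.
  by apply: measurable_funM => //; apply: measurableT_comp => //; exact: measurable_funB.
have mc := mt _ (@continuous_cos R); have ms := mt _ (@continuous_sin R).
have FRe t y : Re (F t y) = f y * (Re (P t) * cos (- (x - y) * t) - Im (P t) * sin (- (x - y) * t)).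
  by rewrite FEt !ReM !ImM /= !mul0r subr0.
have FIm t y : Im (F t y) = f y * (Re (P t) * sin (- (x - y) * t) + Im (P t) * cos (- (x - y) * t)).
  by rewrite FEt !ImM ?ReM /= !mul0r addr0.
have [|||||||_ _ FF] := @CFubini F (fun t y => `|f y| * b t) (fun y => Int b * `|f y|) _ _ sx sy.
- rewrite (_ : (fun p => _) = (fun p => f p.2 * (Re (P p.1) * cos (- (x - p.2) * p.1) - Im (P p.1) * sin (- (x - p.2) * p.1)))).
    by apply: measurable_funM => //; apply: measurable_funB; exact: measurable_funM.
  by apply/funext => p; rewrite FRe.
- rewrite (_ : (fun p => _) = (fun p => f p.2 * (Re (P p.1) * sin (- (x - p.2) * p.1) + Im (P p.1) * cos (- (x - p.2) * p.1)))).
    by apply: measurable_funM => //; apply: measurable_funD; exact: measurable_funM.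
  by apply/funext => p; rewrite FIm.
- by apply: L1Z; exact: L1_norm.
- move=> t y; rewrite FRe normrM ler_wpM2l//; apply: (le_trans (ler_normB _ _)).
  by rewrite !normrM lerD// ler_piMr// ?cos_max ?sin_max.
- move=> t y; rewrite FIm normrM ler_wpM2l//; apply: (le_trans (ler_normD _ _)).
  by rewrite !normrM lerD// ler_piMr// ?cos_max ?sin_max.
- by move=> y; exact: L1Z.
- by move=> y; rewrite mulrC -IntZ.
transitivity (CInt (fun t => CInt (F t))).
  congr (CInt _); apply/funext => t; rewrite /F CIntZ; first by rewrite mulrAC.
  by apply: CL1_cis; exact: CL1_real.
rewrite {}FF.
transitivity (CInt (fun y => (pi *+ 2 * (f y * h (x - y)))%:C)).
  congr (CInt _); apply/funext => y; rewrite FE CIntZ; last exact: CL1_cis.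
  by rewrite Hh -rmorphM mulrCA.
rewrite CInt_real IntZ//.
by apply: (L1_conv_kernel _ lf _ hB); exact: continuous_measurable_fun.
Qed.

(** * Truncated exponentials and the Gamma function *)

Lemma is_derive1X n f (x df : R) : is_derive x 1 f df ->
  is_derive x 1 (fun t => f t ^+ n) (n%:R * f x ^+ n.-1 * df).
Proof.
move=> hf; have -> : (fun t => f t ^+ n) = f ^+ n.
  by elim: n => [|n IH]; apply/funext => t; rewrite ?expr0// !exprS -IH.
exact: is_deriveX.
Qed.

Definition exp_tail (N : nat) (w : R) := expR (- w) - \sum_(k < N) (- w) ^+ k / k`!%:R :> R.

Lemma exp_tail0 (w : R) : exp_tail 0 w = expR (- w).
Proof. by rewrite /exp_tail big_ord0 subr0. Qed.

Lemma exp_tailS N (w : R) : exp_tail N.+1 w = exp_tail N w - (- w) ^+ N / N`!%:R.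
Proof. by rewrite /exp_tail big_ord_recr /= opprD addrA. Qed.

(** The truncated predecessor is right at [N = 0] too, where the tail is [exp (- w)] and
    differentiation only changes the sign. *)
Lemma is_derive_exp_tail N (w : R) :
  is_derive w 1 (exp_tail N) (- exp_tail N.-1 w).
Proof.
have dN : is_derive w 1 (fun t : R => - t) (-1) by exact: is_deriveNid.
elim: N => [|N IH].
  have -> : exp_tail 0 = fun w => expR (- w) by apply/funext => x; rewrite exp_tail0.
  by apply: (is_derive_eq (is_derive1_exp dN)); rewrite mulN1r.
have -> : exp_tail N.+1 = fun w => exp_tail N w + - (N`!%:R^-1 * (- w) ^+ N).
  by apply/funext => x; rewrite exp_tailS mulrC.
apply: (is_derive_eq (is_derive1D IH (is_derive1N (is_derive1Z _ (is_derive1X N dN))))).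
case: N {IH} => [|N] /=; first by rewrite !mul0r mulr0 oppr0 addr0.
rewrite [in RHS]exp_tailS [RHS]opprD; congr (_ + _).
have f0 : N.+1%:R != 0 :> R by rewrite pnatr_eq0.
have f1 : N`!%:R != 0 :> R by rewrite pnatr_eq0 -lt0n fact_gt0.
by rewrite factS natrM; move: (N.+1%:R : R) (N`!%:R : R) f0 f1 => a b f0 f1; field; rewrite f0 f1.
Qed.

Lemma exp_tail_at0 N : exp_tail N.+1 0 = 0.
Proof.
elim: N => [|N IH]; first by rewrite exp_tailS exp_tail0 oppr0 expR0 expr0 fact0 divr1 subrr.
by rewrite exp_tailS IH oppr0 expr0n/= mul0r subrr.
Qed.

Lemma continuous_exp_tail N : continuous (exp_tail N).
Proof. by apply: continuous_of_derive => w; exact: is_derive_exp_tail. Qed.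

(** By induction: the signed tail of order [N + 1] vanishes at 0 and has the signed tail of order
    [N] as its derivative. *)
Lemma exp_tail_sign N (w : R) : 0 <= w -> 0 <= (-1) ^+ N * exp_tail N w.
Proof.
elim: N w => [|N IH] w w0; first by rewrite expr0 mul1r exp_tail0 expR_ge0.
have [||c cw] := @MVT_segment _ (exp_tail N.+1) (fun w => - exp_tail N w) 0 w w0.
- by move=> x _; exact: is_derive_exp_tail.
- by apply: continuous_subspaceT; exact: continuous_exp_tail.
rewrite exp_tail_at0 !subr0 => ->.
rewrite exprS mulN1r mulrA mulrNN mulr_ge0//; apply: IH.
by move: cw; rewrite in_itv/= => /andP[].
Qed.

Lemma exp_tail_signS N (w : R) :
  (-1) ^+ N.+1 * exp_tail N.+1 w = w ^+ N / N`!%:R - (-1) ^+ N * exp_tail N w.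
Proof.
have : (-1) ^+ N * (-1) ^+ N = 1 :> R.
  by rewrite -exprD addnn -signr_odd odd_double expr0.
rewrite exp_tailS exprS (exprNn w); move: ((-1) ^+ N) => e e2.
transitivity (e * e * (w ^+ N / N`!%:R) - e * exp_tail N w); first by ring.
by rewrite e2 mul1r.
Qed.

(** Two consecutive signed tails are nonnegative with sum [w^N / N!], so each is at most that. This
    form serves for [w <= 1], the following one for [w >= 1]. *)
Lemma exp_tail_small N (w : R) : 0 <= w -> `|exp_tail N w| <= w ^+ N / N`!%:R.
Proof.
move=> w0; have h1 := exp_tail_sign N w0; have := exp_tail_sign N.+1 w0.
by rewrite exp_tail_signS subr_ge0 -(normrMsign N (exp_tail N w)) (ger0_norm h1).
Qed.

Lemma exp_tail_large N (w : R) : 0 <= w -> `|exp_tail N.+1 w| <= w ^+ N / N`!%:R.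
Proof.
move=> w0; have h1 := exp_tail_sign N w0; have h2 := exp_tail_sign N.+1 w0.
by rewrite -(normrMsign N.+1) (ger0_norm h2) exp_tail_signS gerDl oppr_le0.
Qed.

Definition strip (N : nat) c := (- N%:R < c) && ((N == 0%N) || (c < 1 - N%:R)).

Definition wtail (N : nat) c x := expR (c * x) * exp_tail N (expR x).

Lemma expR_natpow (N : nat) x : expR x ^+ N = expR (N%:R * x).
Proof. by rewrite expRM_natl. Qed.

(** The two inequalities of [strip] are the decay conditions at the two ends: rate [c + N] at minus
    infinity, and rate [1 - N - c] at plus infinity when [N] is positive. For [N = 0] the factor
    [exp (- exp x)] beats every exponential. *)
Lemma wtail_bound N c : strip N c ->
  exists2 K : R, 0 <= K & exists2 e : R, 0 < e & forall x, `|wtail N c x| <= K * expR (- e * `|x|).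
Proof.
move=> /andP[cN1 cN2].
have fact1 (n : nat) (a : R) : 0 <= a -> a / n`!%:R <= a.
  move=> a0; rewrite ler_pdivrMr ?ltr0n ?fact_gt0//.
  by rewrite ler_peMr// ler1n fact_gt0.
have neg x : x <= 0 -> `|wtail N c x| <= expR (- (c + N%:R) * `|x|).
  move=> x0; rewrite normrM (ger0_norm (expR_ge0 _)).
  apply: (@le_trans _ _ (expR (c * x) * expR x ^+ N)).
    rewrite ler_wpM2l ?expR_ge0//.
    apply: (le_trans (exp_tail_small _ (expR_ge0 _))).
    by apply: fact1; rewrite exprn_ge0 ?expR_ge0.
  by rewrite expR_natpow -expRD ler0_norm// mulrNN -mulrDl.
have cN0 : 0 < c + N%:R by lra.
have [K K1 [e e0 pos]] : exists2 K : R, 1 <= K & exists2 e : R, 0 < e & forall x, 0 <= x -> `|wtail N c x| <= K * expR (- e * `|x|).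
  case: N cN1 cN2 neg cN0 => [|N] cN1 cN2 neg cN0.
    (* An integer above [c]; from [w^M / M! <= exp w] one gets the rate [M - c]. *)
    pose M := (Num.truncn `|c|).+1.
    have cM : c < M%:R by apply: le_lt_trans (ler_norm _) _; exact: truncnS_gt.
    exists M`!%:R; first by rewrite ler1n fact_gt0.
    exists (M%:R - c); first by rewrite subr_gt0.
    move=> x x0; rewrite normrM (ger0_norm (expR_ge0 _)) exp_tail0 ger0_norm ?expR_ge0//.
    have E : expR (- expR x) <= M`!%:R * expR (- M%:R * x).
      rewrite expRN mulNr expRN -expR_natpow ler_pdivlMr ?exprn_gt0 ?expR_gt0// mulrC ler_pdivrMr ?expR_gt0//.
      have := @expR_ge1Dxn R (expR x) (Num.truncn `|c|) (expR_ge0 _).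
      rewrite -/M -(@ler_pM2l _ M`!%:R) ?ltr0n ?fact_gt0//; apply: le_trans.
      rewrite mulrDr mulrCA divff ?mulr1 ?lerDr ?ler0n//.
    apply: (@le_trans _ _ (expR (c * x) * (M`!%:R * expR (- M%:R * x)))).
      by rewrite ler_wpM2l ?expR_ge0.
    by rewrite mulrCA -expRD ger0_norm// -mulrDl opprB.
  exists 1 => //; exists (- c - N%:R).
    by move: cN2 => /=; rewrite -natr1; lra.
  move=> x x0; rewrite mul1r normrM (ger0_norm (expR_ge0 _)).
  apply: (@le_trans _ _ (expR (c * x) * expR x ^+ N)).
    rewrite ler_wpM2l ?expR_ge0//.
    apply: (le_trans (exp_tail_large _ (expR_ge0 _))).
    by apply: fact1; rewrite exprn_ge0 ?expR_ge0.
  by rewrite expR_natpow -expRD ger0_norm// -mulrDl opprB opprK addrC.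
exists K; first by rewrite (le_trans _ K1).
exists (Num.min e (c + N%:R)); first by rewrite lt_min e0 cN0.
move=> x; have [x0|x0] := leP 0 x.
  apply: (le_trans (pos x x0)); rewrite ler_wpM2l ?(le_trans _ K1)//.
  by rewrite ler_expR !mulNr lerN2 ler_wpM2r// ge_min lexx.
apply: (le_trans (neg x (ltW x0))).
apply: (@le_trans _ _ (1 * expR (- (c + N%:R) * `|x|))); first by rewrite mul1r.
apply: ler_pM => //; rewrite ?expR_ge0//.
by rewrite ler_expR !mulNr lerN2 ler_wpM2r// ge_min lexx orbT.
Qed.

Lemma is_derive_wtail N c x :
  is_derive x 1 (wtail N c) (c * wtail N c x - wtail N.-1 (c + 1) x).
Proof.
have dt := is_derive1_comp (is_derive_exp_tail N (expR x)) (is_derive_expR x).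
apply: (is_derive_eq (is_derive1M (is_derive1_exp (is_derive1_lin c x)) dt)).
have -> : wtail N.-1 (c + 1) x = expR (c * x) * expR x * exp_tail N.-1 (expR x).
  by rewrite /wtail mulrDl mul1r expRD.
by rewrite /wtail /=; ring.
Qed.

Lemma continuous_wtail N c : continuous (wtail N c).
Proof. exact: continuous_of_derive (is_derive_wtail N c). Qed.

Lemma wtail_L1 N c : strip N c -> L1 (wtail N c).
Proof.
move=> /wtail_bound[K K0 [e e0 H]]; apply: (L1_dom _ _ H).
  by apply: continuous_measurable_fun; exact: continuous_wtail.
by apply: L1Z; exact: L1_expabs.
Qed.

Lemma wtail_bounded N c : strip N c -> exists B : R, forall x, `|wtail N c x| <= B.
Proof.
move=> /wtail_bound[K K0 [e e0 H]]; exists K => x; apply: (le_trans (H x)).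
by rewrite ler_piMr// expR_le1 mulNr oppr_le0 mulr_ge0// ltW.
Qed.

Lemma cvg_expN_nat e : 0 < e -> (fun n : nat => expR (- e * n%:R)) @ \oo --> (0 : R).
Proof.
move=> e0; have q : `|expR (- e)| < 1 by rewrite ger0_norm ?expR_ge0// expR_lt1 oppr_lt0.
rewrite (_ : (fun n => _) = (fun n => expR (- e) ^+ n)); first exact: cvg_expr q.
by apply/funext => n; rewrite expRM_natr.
Qed.

(** The boundary terms in the integration by parts for [hat_wtail_feq], with [g] a cosine or a
    sine. *)
Lemma wtail_ends N c g : strip N c -> (forall x, `|g x| <= 1) ->
  (fun n : nat => wtail N c n%:R * g n%:R - wtail N c (- n%:R) * g (- n%:R)) @ \oo --> (0 : R).
Proof.
move=> /wtail_bound[K K0 [e e0 H]] g1.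
have E0 : (fun n : nat => (K * expR (- e * n%:R)) *+ 2) @ \oo --> (0 : R).
  rewrite -(mul0rn R 2) -(mulr0 K); apply: cvgMn; apply: cvgM; first exact: cvg_cst.
  exact: cvg_expN_nat.
apply/norm_cvg0P; apply: (@squeeze_cvgr _ _ _ _ (cst 0) (fun n => (K * expR (- e * n%:R)) *+ 2)) => //; last exact: cvg_cst.
apply: nearW => n; rewrite /= normr_ge0/= mulr2n.
apply: (le_trans (ler_normB _ _)).
have m x (y : R) : `|wtail N c x| <= y -> `|wtail N c x * g x| <= y.
  by apply: le_trans; rewrite [leLHS]normrM ler_piMr.
have h1 := H n%:R; have h2 := H (- n%:R); rewrite normrN in h2.
rewrite (ger0_norm (ler0n _ _)) in h1 h2.
by apply: lerD; exact: m.
Qed.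

Lemma strip_pred N c : strip N c -> strip N.-1 (c + 1).
Proof.
rewrite /strip; case: N => [|[|N]] /= /andP[h1 h2]; apply/andP; split => //; try lra.
Qed.

Lemma strip_neq0 N c : strip N c -> c != 0.
Proof.
rewrite /strip; case: N => [|N] /= /andP[h1 h2]; first by rewrite gt_eqF//; lra.
by rewrite lt_eqF// (lt_le_trans h2)// subr_le0 ler1n.
Qed.

(** Integration by parts, once against [cos (t x)] and once against [sin (t x)]; the two real
    identities are the real and imaginary parts. This is the functional equation of Gamma, and for
    positive [N] it passes from one strip to the next. *)
Lemma hat_wtail_feq N c t : strip N c ->
  (c +i* t) * hat (wtail N c) t = hat (wtail N.-1 (c + 1)) t.
Proof.
move=> sN; have sN' := strip_pred sN.
set w := wtail N c; set w' := wtail N.-1 (c + 1).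
have lw : L1 w := wtail_L1 sN; have lw' : L1 w' := wtail_L1 sN'.
have cw : continuous w := @continuous_wtail N c.
have cw' : continuous w' := @continuous_wtail N.-1 (c + 1).
have cc := @continuous_coslin t; have cs := @continuous_sinlin t.
have lcw := L1_cos t lw; have lsw := L1_sin t lw.
have lcw' := L1_cos t lw'; have lsw' := L1_sin t lw'.
have lt x := is_derive1_lin t x.
have cneg (g : R -> R) : continuous g -> continuous (fun x => - g x).
  by move=> cg x; apply: cvgN; exact: cg.
have ccst (k : R) : continuous (fun _ : R => k) by move=> x; exact: cvg_cst.
have D1 x : is_derive x 1 (fun x => w x * cos (t * x)) (c * (w x * cos (t * x)) - w' x * cos (t * x) - t * (w x * sin (t * x))).
  apply: (is_derive_eq (is_derive1M (is_derive_wtail N c x) (is_derive1_cosf (lt x)))).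
  by rewrite -/w -/w'; ring.
have I1 : Int (fun x => c * (w x * cos (t * x)) - w' x * cos (t * x) - t * (w x * sin (t * x))) = 0.
  apply: (@Int_FTC _ _ _ _ D1).
  - apply: continuous_add; first apply: continuous_add.
    + by apply: continuous_mul => //; exact: continuous_mul.
    + by apply: cneg; exact: continuous_mul.
    + by apply: cneg; apply: continuous_mul => //; exact: continuous_mul.
  - by apply: L1B; [apply: L1B => //; exact: L1Z|exact: L1Z].
  - by apply: (@wtail_ends _ _ (fun x => cos (t * x))) => // x; exact: cos_max.
have D2 x : is_derive x 1 (fun x => w x * sin (t * x)) (c * (w x * sin (t * x)) - w' x * sin (t * x) + t * (w x * cos (t * x))).
  apply: (is_derive_eq (is_derive1M (is_derive_wtail N c x) (is_derive1_sinf (lt x)))).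
  by rewrite -/w -/w'; ring.
have I2 : Int (fun x => c * (w x * sin (t * x)) - w' x * sin (t * x) + t * (w x * cos (t * x))) = 0.
  apply: (@Int_FTC _ _ _ _ D2).
  - apply: continuous_add; first apply: continuous_add.
    + by apply: continuous_mul => //; exact: continuous_mul.
    + by apply: cneg; exact: continuous_mul.
    + by apply: continuous_mul => //; exact: continuous_mul.
  - by apply: L1D; [apply: L1B => //; exact: L1Z|exact: L1Z].
  - by apply: (@wtail_ends _ _ (fun x => sin (t * x))) => // x; exact: sin_max.
have lc1 := L1Z c lcw; have lc2 := L1Z c lsw; have ls1 := L1Z t lsw; have ls2 := L1Z t lcw.
rewrite IntB// in I1; last exact: L1B.
rewrite IntB// in I1; rewrite !IntZ// in I1.
rewrite IntD// in I2; last exact: L1B.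
rewrite IntB// in I2; rewrite !IntZ// in I2.
rewrite !hatE; apply: complex_ext; rewrite ?ReM ?ImM /=; lra.
Qed.

(** The modulus as an element of [R], whereas the norm on [R[i]] takes its values in [R[i]]. *)
Definition cnorm z : R := Num.sqrt (Re z ^+ 2 + Im z ^+ 2).

Lemma cnormM z (k : R[i]) : cnorm (z * k) = cnorm z * cnorm k.
Proof.
rewrite /cnorm -sqrtrM ?addr_ge0 ?sqr_ge0// ReM ImM; congr Num.sqrt; ring.
Qed.

Lemma cnorm_ge0 z : 0 <= cnorm z.
Proof. exact: sqrtr_ge0. Qed.

Lemma Re_le_cnorm z : `|Re z| <= cnorm z.
Proof. by rewrite -sqrtr_sqr ler_wsqrtr// lerDl sqr_ge0. Qed.

Lemma Im_le_cnorm z : `|Im z| <= cnorm z.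
Proof. by rewrite -sqrtr_sqr ler_wsqrtr// lerDr sqr_ge0. Qed.

Lemma cnorm_le z : cnorm z <= `|Re z| + `|Im z|.
Proof.
rewrite -[leRHS]ger0_norm ?addr_ge0// -sqrtr_sqr ler_wsqrtr// sqrrD !real_normK ?num_real//.
by rewrite addrAC lerDl mulrn_wge0 ?mulr_ge0.
Qed.

(** Two steps of the functional equation show the transform to be a bounded function divided by
    [(c + i t) (c + 1 + i t)], hence dominated by a multiple of [1 / (1 + t^2)]. *)
Lemma hat_wtail_CL1 N c : strip N c -> CL1 (hat (wtail N c)).
Proof.
move=> sN; have sN' := strip_pred sN; have sN'' := strip_pred sN'.
have c0 := strip_neq0 sN; have c1 := strip_neq0 sN'.
have [cr ci] := hat_continuous (wtail_L1 sN).
set g := wtail N.-1.-1 (c + 1 + 1).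
have lg : L1 g := wtail_L1 sN''.
(* Chosen so that [m (1 + t^2) <= a^2 + t^2] for [a = c] and [a = c + 1], both of which are
   nonzero. *)
pose m := Num.min 1 (Num.min (c ^+ 2) ((c + 1) ^+ 2)).
have m0 : 0 < m by rewrite !lt_min ltr01 !exprn_even_gt0//= c0 c1.
pose C := Int (fun x => `|g x|) *+ 2.
have key t : cnorm (hat (wtail N c) t) <= C / m * (1 + t ^+ 2)^-1.
  have d0 : 0 < 1 + t ^+ 2 by rewrite ltr_pwDl ?sqr_ge0.
  rewrite ler_pdivlMr// ler_pdivlMr//.
  have H : cnorm (((c + 1) +i* t) * ((c +i* t) * hat (wtail N c) t)) <= C.
    rewrite hat_wtail_feq// hat_wtail_feq//; apply: (le_trans (cnorm_le _)).
    by rewrite /C mulr2n lerD//; case: (hat_bounded t lg).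
  apply: le_trans H; rewrite mulrA !cnormM -mulrA [leRHS]mulrC ler_wpM2l ?cnorm_ge0//.
  have q (a : R) : m <= a ^+ 2 -> Num.sqrt (m * (1 + t ^+ 2)) <= cnorm (a +i* t).
    move=> ma; rewrite ler_wsqrtr//= mulrDr mulr1 lerD// ler_piMl ?sqr_ge0//.
    by rewrite ge_min lexx.
  rewrite mulrC -[leLHS]sqr_sqrtr; last by rewrite mulr_ge0// ltW.
  rewrite expr2 ler_pM ?sqrtr_ge0// q// !ge_min lexx ?orbT//.
have lb : L1 (fun t => C / m * (1 + t ^+ 2)^-1) by apply: L1Z; exact: L1_cauchy.
split.
  apply: (L1_dom _ lb); first exact: continuous_measurable_fun.
  by move=> t; exact: le_trans (Re_le_cnorm _) (key t).
apply: (L1_dom _ lb); first exact: continuous_measurable_fun.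
by move=> t; exact: le_trans (Im_le_cnorm _) (key t).
Qed.

(** Under [u = exp x] the measure [u^(s - 1) du] becomes [exp (s x) dx]; the modulus of the
    exponential goes into the weight and its phase is the Fourier kernel. *)
Lemma mellin_hat (h : R -> R) (g : R -> R[i]) (s : R[i]) : continuous h ->
  (forall x : R, 0 < x -> g x = (h (ln x))%:C) -> L1 (fun x => expR (Re s * x) * h x) ->
  cintegrable [set` `]0, +oo[] (mellin_integrand g s) /\
  mellin g s = hat (fun x => expR (Re s * x) * h x) (Im s).
Proof.
move=> ch gh lh; set f := fun x => _ in lh *.
have cf : continuous f.
  apply: continuous_mul => //.
  by apply: continuous_comp1; [exact: continuous_expR|exact: continuous_lin].
have [i1 e1] := exp_substitution (continuous_mul cf (@continuous_coslin (Im s))) (L1_cos (Im s) lh).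
have [i2 e2] := exp_substitution (continuous_mul cf (@continuous_sinlin (Im s))) (L1_sin (Im s) lh).
have E x : x \in [set` `]0, +oo[] -> mellin_integrand g s x =
    (f (ln x) * cos (Im s * ln x) / x) +i* (f (ln x) * sin (Im s * ln x) / x).
  rewrite inE/= in_itv/= andbT => x0.
  have ex : expR ((Re s - 1) * ln x) = expR (Re s * ln x) / x.
    by rewrite mulrBl mul1r expRB lnK ?posrE.
  rewrite /mellin_integrand /cpow gh// raddfB/= raddfB/= subr0 ex /f.
  by apply: complex_ext; rewrite !(ReM, ImM) /=; ring.
split; first split.
- apply: eq_integrable i1 => // x xD; by rewrite /= E.
- apply: eq_integrable i2 => // x xD; by rewrite /= E.
rewrite hatE -e1 -e2 /mellin /cintegral; congr (_ +i* _); apply: eq_Rintegral => x xD; by rewrite E.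
Qed.

Lemma euler_integral_hat c t : 0 < c -> euler_integral (c +i* t) = hat (wtail 0 c) t.
Proof.
move=> c0; have s0 : strip 0 c by rewrite /strip oppr0 c0.
have E : wtail 0 c = fun x => expR (c * x) * expR (- expR x).
  by apply/funext => x; rewrite /wtail exp_tail0.
rewrite /euler_integral.
have [|||_ ->] := @mellin_hat (fun x => expR (- expR x)) (fun t => (expR (- t))%:C) (c +i* t).
- have -> : (fun x => expR (- expR x)) = wtail 0 0.
    by apply/funext => x; rewrite /wtail exp_tail0 mul0r expR0 mul1r.
  exact: continuous_wtail.
- by move=> x x0; rewrite lnK.
- by have := wtail_L1 s0; rewrite E.
- by rewrite E.
Qed.

Lemma euler_integral_feq z : 0 < Re z -> euler_integral (z + 1) = z * euler_integral z.
Proof.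
case: z => c t /= c0; have s0 : strip 0 c by rewrite /strip oppr0 c0.
have -> : (c +i* t) + 1 = (c + 1) +i* t by apply: complex_ext => //=; rewrite addr0.
by rewrite !euler_integral_hat ?addr_gt0// hat_wtail_feq.
Qed.

(** At a negative integer both sides are 0, because the quotients that define [Gamma] there are
    divisions by zero. Hence 0 is the only exception. *)
Lemma Gamma_feq z : z != 0 -> Gamma (z + 1) = z * Gamma z.
Proof.
move=> z0; rewrite /Gamma; have R1 : Re (z + 1) = Re z + 1 by rewrite raddfD.
rewrite R1; have [zp|zn] := ltP 0 (Re z).
  by rewrite addr_gt0// euler_integral_feq.
have [zp'|zn'] := ltP 0 (Re z + 1).
  have -> : Num.truncn `|Re z| = 0%N.
    by apply: truncn_def; rewrite normr_ge0 ler0_norm//=; lra.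
  by rewrite big_ord_recl big_ord0 addr0 mulr1 mulrCA divff// mulr1.
(* For [Re z <= -1] the shift used at [z] is one more than at [z + 1]: both lead to the same Euler
   integral, and the products differ by the factor [z]. *)
set M := Num.truncn `|Re z + 1|.
have -> : Num.truncn `|Re z| = M.+1.
  apply: truncn_def; have := @truncn_itv _ `|Re z + 1| (normr_ge0 _).
  by rewrite -/M !ler0_norm// -[M.+2%:R]natr1 -[M.+1%:R]natr1; lra.
have -> : z + 1 + M.+1%:R = z + M.+2%:R by rewrite -addrA -[M.+2]add1n natrD.
have -> : \prod_(k < M.+2) (z + k%:R) = z * \prod_(k < M.+1) (z + 1 + k%:R).
  rewrite big_ord_recl addr0; congr (_ * _); apply: eq_bigr => i _.
  by rewrite lift0 -addrA -[i.+1]add1n natrD.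
by rewrite invfM mulrCA (mulrA z) divff// mul1r.
Qed.

(** Both sides obey the same functional equation, so induction on [N] carries Euler's integral to
    every strip; one may divide by [c + i t] because [c] is nonzero. *)
Lemma hat_wtail_Gamma N c t : strip N c -> hat (wtail N c) t = Gamma (c +i* t).
Proof.
elim: N c => [|N IH] c sN.
  have c0 : 0 < c by move: sN; rewrite /strip oppr0 orTb andbT.
  by rewrite -euler_integral_hat// /Gamma /= c0.
have z0 : c +i* t != 0 by rewrite eq_complex /= negb_and (strip_neq0 sN).
apply: (mulfI z0); rewrite hat_wtail_feq//= IH; last exact: (strip_pred sN).
rewrite -Gamma_feq//; congr Gamma; by apply: complex_ext => //=; rewrite addr0.
Qed.

Lemma Gamma_inversion N c x : strip N c ->
  CL1 (fun t => Gamma (c +i* t)) /\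
  CInt (fun t => Gamma (c +i* t) * cis (- x * t)) = (pi *+ 2 * wtail N c x)%:C.
Proof.
move=> sN; have [B HB] := wtail_bounded sN.
have E : (fun t => Gamma (c +i* t)) = hat (wtail N c).
  by apply/funext => t; rewrite (hat_wtail_Gamma t sN).
have := hat_inversion x (@continuous_wtail N c) (wtail_L1 sN) HB (hat_wtail_CL1 sN).
rewrite -E; split => //; rewrite E; exact: hat_wtail_CL1.
Qed.

(** * Mellin pairs *)

(** The inverse Mellin integral at [u = exp x], the [i] of [ds = i dt] being cancelled against
    [1 / (2 pi i)]; see [inverse_mellinE]. *)
Definition inversion P c x : R[i] :=
  (expR (- (c * x)) / (pi *+ 2))%:C * CInt (fun t => P (c +i* t) * cis (- x * t)).

Definition weighted (h : R -> R) c x := expR (c * x) * h x.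

(** A collection of facts stable under convolution. The function [h] does not depend on [c]: all
    lines with abscissa in [S] have the same inverse, so the line may be moved within [S] without a
    contour argument. *)
Definition mellin_pair (h : R -> R) (P : R[i] -> R[i]) (S : R -> Prop) :=
  forall c, S c -> [/\ L1 (weighted h c),
    forall t, hat (weighted h c) t = P (c +i* t),
    CL1 (fun t => P (c +i* t)) &
    forall x, CInt (fun t => P (c +i* t) * cis (- x * t)) = (pi *+ 2 * weighted h c x)%:C].

Lemma pi2_neq0 : pi *+ 2 != 0 :> R.
Proof. by rewrite mulrn_eq0/= gt_eqF// pi_gt0. Qed.

Lemma mellin_pair_inversion (h : R -> R) P S c x : mellin_pair h P S -> S c ->
  inversion P c x = (h x)%:C.
Proof.
move=> hP Sc; have [_ _ _ H] := hP c Sc.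
rewrite /inversion H -rmorphM /weighted; congr (_%:C).
have -> : expR (- (c * x)) / (pi *+ 2) * (pi *+ 2 * (expR (c * x) * h x)) =
  expR (- (c * x)) * expR (c * x) * h x
  by move: (pi *+ 2 : R) pi2_neq0 => k k0; field.
by rewrite -expRD addNr expR0 mul1r.
Qed.

Lemma weighted_wtail p N c : weighted (wtail N p) c = wtail N (c + p).
Proof. by apply/funext => x; rewrite /weighted /wtail mulrA -expRD mulrDl. Qed.

Lemma complex_addr c t p : (c +i* t) + p%:C = (c + p) +i* t.
Proof. by apply: complex_ext; rewrite /= ?addr0. Qed.

Lemma wtail_pair p N :
  mellin_pair (wtail N p) (fun s => Gamma (s + p%:C)) (fun c => strip N (c + p)).
Proof.
move=> c sN; rewrite weighted_wtail.
have E : (fun t => Gamma (c +i* t + p%:C)) = (fun t => Gamma ((c + p) +i* t)).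
  by apply/funext => t; rewrite complex_addr.
split.
- exact: wtail_L1.
- by move=> t; rewrite complex_addr hat_wtail_Gamma.
- by rewrite E; case: (Gamma_inversion 0 sN).
- move=> x; have [_ <-] := Gamma_inversion x sN.
  by congr (CInt _); apply/funext => t; rewrite complex_addr.
Qed.

Lemma mellin_pair_bounded (h : R -> R) P S c : mellin_pair h P S -> S c ->
  exists B : R, forall x, `|weighted h c x| <= B.
Proof. by move=> hP Sc; have [_ _ lP H] := hP c Sc; exact: (inversion_bounded lP). Qed.

Lemma L1_pair_kernel f (h : R -> R) P S c x : mellin_pair h P S -> S c ->
  L1 (weighted f c) -> L1 (fun y => f y * h (x - y)).
Proof.
move=> hP Sc lf; have [lh _ _ _] := hP c Sc.
have [B hB] := mellin_pair_bounded hP Sc.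
have -> : (fun y => f y * h (x - y)) =
    (fun y => expR (- (c * x)) * (weighted f c y * weighted h c (x - y))).
  apply/funext => y; rewrite /weighted mulrACA -expRD [RHS]mulrA -expRD.
  have -> : - (c * x) + (c * y + c * (x - y)) = 0 by ring.
  by rewrite expR0 mul1r.
exact: L1Z (L1_conv_kernel x lf (L1_measurable lh) hB).
Qed.

Lemma weighted_conv f (h : R -> R) P S c : mellin_pair h P S -> S c ->
  L1 (weighted f c) -> weighted (conv f h) c = conv (weighted f c) (weighted h c).
Proof.
move=> hP Sc lf; apply/funext => x; rewrite {1}/weighted /conv -IntZ; last exact: L1_pair_kernel hP Sc lf.
apply: eq_Rintegral => y _; rewrite /weighted mulrACA -expRD; congr (expR _ * _); ring.
Qed.

Lemma conv_pair p N (h : R -> R) P S : mellin_pair h P S ->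
  mellin_pair (conv (wtail N p) h) (fun s => P s * Gamma (s + p%:C))
    (fun c => S c /\ strip N (c + p)).
Proof.
move=> hP c [Sc sN]; have [lh hh lP iP] := hP c Sc.
have [B hB] := mellin_pair_bounded hP Sc.
have [lt ht _ _] := wtail_pair sN.
rewrite (weighted_conv hP Sc lt).
have [c1 c2] := hat_continuous lt.
have E : (fun t => P (c +i* t) * Gamma (c +i* t + p%:C)) =
         (fun t => P (c +i* t) * hat (weighted (wtail N p) c) t).
  by apply/funext => t; rewrite ht.
split.
- exact: conv_L1 hB.
- by move=> t; rewrite (conv_hat t lt lh hB) ht hh mulrC.
- rewrite E; apply: (@CL1_mul_bounded _ _ (Int (fun x => `|weighted (wtail N p) c x|)) lP).
  + exact: continuous_measurable_fun.
  + exact: continuous_measurable_fun.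
  + by move=> t; case: (hat_bounded t lt).
  + by move=> t; case: (hat_bounded t lt).
- move=> x; rewrite -(conv_inversion x lP lt iP); congr (CInt _); apply/funext => t.
  by rewrite ht.
Qed.

Lemma mellin_pair_sub (h : R -> R) P P' (S S' : R -> Prop) : mellin_pair h P S ->
  P =1 P' -> (forall c, S' c -> S c) -> mellin_pair h P' S'.
Proof.
move=> hP /funext <- SS c /SS; exact: hP.
Qed.

(** The list is nonempty because the empty product 1 is not the transform of an integrable function.
    For the same reason a single factor is treated apart in [crossing_single]. *)
Lemma gamma_product_pair (I : eqType) (p : I -> R) (N : I -> nat) (s : seq I) :
  s != [::] -> exists h : R -> R,
    mellin_pair h (fun z => \prod_(j <- s) Gamma (z + (p j)%:C))
      (fun c => forall j, j \in s -> strip (N j) (c + p j)).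
Proof.
elim: s => // j [|k s] IH _.
  exists (wtail (N j) (p j)); apply: (mellin_pair_sub (wtail_pair (N := N j))).
    by move=> z; rewrite big_seq1.
  by move=> c; apply; rewrite mem_head.
have [h hP] := IH isT; exists (conv (wtail (N j) (p j)) h).
apply: (mellin_pair_sub (conv_pair (p := p j) (N := N j) hP)).
  by move=> z; rewrite [RHS]big_cons mulrC.
by move=> c H; split; [move=> i i_s; apply: H; rewrite in_cons i_s orbT|apply: H; rewrite mem_head].
Qed.

Lemma wtail_diff p q x : wtail q p x - wtail q.+1 p x = (-1) ^+ q / q`!%:R * expR ((p + q%:R) * x).
Proof.
rewrite /wtail exp_tailS (exprNn (expR x)) expR_natpow mulrDl expRD; ring.
Qed.

Lemma crossing_single p q c c' x : strip q.+1 (c + p) -> strip q (c' + p) ->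
  inversion (fun s => Gamma (s + p%:C)) c' x - inversion (fun s => Gamma (s + p%:C)) c x =
  ((-1) ^+ q / q`!%:R * expR ((p + q%:R) * x))%:C.
Proof.
move=> s1 s2.
rewrite (mellin_pair_inversion x (@wtail_pair p q) s2) (mellin_pair_inversion x (@wtail_pair p q.+1) s1).
by rewrite -rmorphB wtail_diff.
Qed.

(** With [a = p + q], the two truncations differ by a multiple of [exp (a x)]. Convolving
    [exp (a x)] with [h] gives [exp (a x)] times the integral of [exp (- a y) h y], that is, times
    [P (- a)]; this is why [S] must contain the abscissa of the pole. *)
Lemma crossing_conv (h : R -> R) P S p q c c' x : mellin_pair h P S ->
  S c -> S c' -> S (- (p + q%:R)) -> strip q.+1 (c + p) -> strip q (c' + p) ->
  inversion (fun s => P s * Gamma (s + p%:C)) c' x - inversion (fun s => P s * Gamma (s + p%:C)) c x =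
  ((-1) ^+ q / q`!%:R * expR ((p + q%:R) * x))%:C * P (- (p + q%:R))%:C.
Proof.
move=> hP Sc Sc' S0 s1 s2.
rewrite (mellin_pair_inversion x (conv_pair hP) (conj Sc' s2)).
rewrite (mellin_pair_inversion x (conv_pair hP) (conj Sc s1)).
rewrite -rmorphB /conv -IntB; first last.
- by have [l _ _ _] := wtail_pair s1; exact: L1_pair_kernel hP Sc l.
- by have [l _ _ _] := wtail_pair s2; exact: L1_pair_kernel hP Sc' l.
have [l0 h0 _ _] := hP _ S0; set a := p + q%:R in l0 h0 *.
have -> : P (- a)%:C = (Int (weighted h (- a)))%:C.
  rewrite -[(- a)%:C]/((- a) +i* 0) -h0 /hat -CInt_real.
  by congr (CInt _); apply/funext => y; rewrite mul0r cis0 mulr1.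
rewrite -rmorphM -(Int_reflect x l0) -IntZ; last exact: L1_reflect.
congr (_%:C); apply: eq_Rintegral => y _.
rewrite -mulrBl wtail_diff -/a /weighted -!mulrA [in RHS](mulrA (expR _)) -expRD.
congr (_ * (_ * (expR _ * _))); ring.
Qed.

Lemma crossing n (p : 'I_n -> R) (N : 'I_n -> nat) j q c c' x :
  strip q.+1 (c + p j) -> strip q (c' + p j) ->
  (forall m, m != j -> [/\ strip (N m) (c + p m), strip (N m) (c' + p m) &
     strip (N m) (- (p j + q%:R) + p m)]) ->
  inversion (gamma_product p) c' x - inversion (gamma_product p) c x =
  ((-1) ^+ q / q`!%:R * expR ((p j + q%:R) * x))%:C *
    \prod_(m < n | m != j) Gamma ((- (p j + q%:R))%:C + (p m)%:C).
Proof.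
move=> s1 s2 sm.
pose s := [seq m <- index_enum 'I_n | m != j].
pose P z := \prod_(m <- s) Gamma (z + (p m)%:C).
have PE z : P z = \prod_(m < n | m != j) Gamma (z + (p m)%:C).
  by rewrite /P big_filter.
have GE : gamma_product p = fun z => P z * Gamma (z + (p j)%:C).
  by apply/funext => z; rewrite /gamma_product (bigD1 j)//= mulrC PE.
rewrite GE -PE.
have [s0|s0] := eqVneq s [::].
  have P1 z : P z = 1 by rewrite /P s0 big_nil.
  rewrite P1 mulr1 -(crossing_single x s1 s2).
  by congr (inversion _ _ _ - inversion _ _ _); apply/funext => z; rewrite P1 mul1r.
have [h hP] := gamma_product_pair p N s0.
apply: (crossing_conv x hP) => // m; rewrite mem_filter => /andP[mj _];
  by case: (sm m mj).
Qed.

Lemma inversion_strip n (p : 'I_n -> R) (N : 'I_n -> nat) c c' x : (0 < n)%N ->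
  (forall m, strip (N m) (c + p m)) -> (forall m, strip (N m) (c' + p m)) ->
  inversion (gamma_product p) c' x = inversion (gamma_product p) c x.
Proof.
move=> n0 s1 s2.
have e0 : enum 'I_n != [::] by rewrite -size_eq0 size_enum_ord -lt0n.
have [h hP] := gamma_product_pair p N e0.
have GE : gamma_product p = fun z => \prod_(m <- enum 'I_n) Gamma (z + (p m)%:C).
  by apply/funext => z; rewrite /gamma_product big_enum.
by rewrite GE !(mellin_pair_inversion x hP).
Qed.

(** * Moving the line of integration *)

Lemma exists_below n (b : 'I_n -> R) : (forall m, 0 < b m) ->
  exists2 d : R, 0 < d < 1 & forall m, d < b m.
Proof.
move=> b0; pose D := \big[Num.min/1]_(m < n) b m.
have D0 : 0 < D by apply: lt_bigmin.
have D2 : D / 2 < D by rewrite ltr_pdivrMr// ltr_pMr// ltr1n.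
exists (D / 2).
  by rewrite divr_gt0//= (lt_le_trans D2)//; exact: bigmin_le_id.
by move=> m; rewrite (lt_le_trans D2)//; exact: bigmin_le_cond.
Qed.

Definition residue n (p : 'I_n -> R) x (j : 'I_n) (q : nat) : R[i] :=
  ((-1) ^+ q / q`!%:R * expR ((p j + q%:R) * x))%:C *
    \prod_(m < n | m != j) Gamma ((- (p j + q%:R))%:C + (p m)%:C).

(** [N j] counts the poles of the [j]-th factor between the two lines. The induction is on their
    total number: the line at [c] moves right over the nearest pole, which lowers a single [N j] by
    one. *)
Lemma sum_residues n (p : 'I_n -> R) (N : 'I_n -> nat) c0 c x : (0 < n)%N ->
  (forall i j, i != j -> p i - p j \isn't a Num.int) ->
  (forall m, 0 < c0 + p m) -> (forall m, strip (N m) (c + p m)) ->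
  inversion (gamma_product p) c0 x - inversion (gamma_product p) c x =
  \sum_(j < n) \sum_(q < N j) residue p x j q.
Proof.
move=> n0 pint cp0; move: {2}(\sum_(j < n) N j)%N (erefl (\sum_(j < n) N j)%N) => k.
elim: k N c => [|k IH] N c sN sc.
  have N0 m : N m = 0%N.
    by apply/eqP; rewrite -leqn0 -sN (bigD1 m)//= leq_addr.
  rewrite (@inversion_strip _ p N c c0)//; last first.
    by move=> m; rewrite N0 /strip oppr0 cp0.
  by rewrite subrr big1// => j _; rewrite N0 big_ord0.
have [i0 Ni0] : exists i, (0 < N i)%N.
  apply/existsP; apply: contra_eqT sN => /existsPn H.
  by rewrite big1// => i _; apply/eqP; rewrite -leqn0 leqNgt H.
have [j Nj jmax] := @Order.TotalTheory.arg_maxP _ _ _ i0 (fun i => (0 < N i)%N) (fun i => p i + (N i)%:R) Ni0.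
(* By the choice of j, e0 is the pole nearest to the line Re s = c on its right. *)
set q := (N j).-1; have Njq : N j = q.+1 by rewrite prednK.
pose e0 := - (p j + q%:R).
have ce0 : c < e0.
  by have := sc j; rewrite Njq /strip /= -natr1 /e0 => /andP[_ ?]; lra.
(* The remaining poles of the other factors lie strictly to the right of [e0]: equality would be a
   common pole, and then [p m - p j] would be an integer. *)
have up m : m != j -> (0 < N m)%N -> e0 + p m < 1 - (N m)%:R.
  move=> mj Nm; have jm : p m + (N m)%:R <= p j + (N j)%:R := jmax m Nm.
  move: jm; rewrite Njq le_eqVlt => /predU1P[E|].
    have /negP[] := pint m j mj.
    have -> : p m - p j = q.+1%:R - (N m)%:R by lra.
    by rewrite rpredB// rpred_nat.
  by rewrite /e0 -natr1; lra.
(* A step beyond e0 by less than all b m crosses no other pole. *)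
pose b (m : 'I_n) := if (m != j) && (0 < N m)%N then 1 - (N m)%:R - (e0 + p m) else 1.
have [|d /andP[d0 d1] db] := @exists_below n b.
  by move=> m; rewrite /b; case: ifP => // /andP[mj Nm]; rewrite subr_gt0 up.
pose N' m := if m == j then q else N m.
have low m : - (N m)%:R < e0 + p m.
  by have := sc m; rewrite /strip => /andP[? _]; lra.
have sc0 m : m != j -> strip (N m) (e0 + p m).
  move=> mj; rewrite /strip low/=; case: eqP => //= /eqP; rewrite -lt0n => Nm.
  exact: up.
have scd m : strip (N' m) (e0 + d + p m).
  rewrite /N'; case: ifPn => [/eqP ->|mj].
    by rewrite /strip /e0; apply/andP; split; [lra|apply/orP; right; lra].
  rewrite /strip; apply/andP; split; first by have := low m; lra.
  case: eqP => //= /eqP; rewrite -lt0n => Nm.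
  by have := db m; rewrite /b mj Nm /=; lra.
have sN' : (\sum_(i < n) N' i)%N = k.
  move: sN; rewrite (bigD1 j)//= [in X in _ -> X](bigD1 j)//= /N' eqxx Njq addSn => -[<-].
  by congr addn; apply: eq_bigr => m /negbTE ->.
have := IH N' (e0 + d) sN' scd.
have cr : inversion (gamma_product p) (e0 + d) x - inversion (gamma_product p) c x = residue p x j q.
  apply: (@crossing _ _ N).
  - by rewrite -Njq.
  - by have := scd j; rewrite /N' eqxx.
  - move=> m mj; split; [exact: sc| |exact: sc0].
    by have := scd m; rewrite /N' (negbTE mj).
move: (inversion _ c0 x) (inversion _ (e0 + d) x) (inversion _ c x) cr => A B D cr H.
have -> : A - D = (A - B) + (B - D) by ring.
rewrite H cr.
rewrite (bigD1 j)//= [in RHS](bigD1 j)//= /N' eqxx Njq big_ord_recr /= addrAC; congr (_ + _ + _).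
by apply: eq_bigr => m /negbTE ->.
Qed.

(** Each step to the left divides by [z - k - 1], whose modulus is at least [k + 1] as [Re z] is
    negative. *)
Lemma Gamma_shift_bound z (k : nat) : Re z < 0 ->
  cnorm (Gamma (z - k%:R)) * k`!%:R <= cnorm (Gamma z).
Proof.
move=> z0; elim: k => [|k IH]; first by rewrite subr0 fact0 mulr1.
apply: le_trans IH; set y := z - k.+1%:R.
have Ry : Re y = Re z - k.+1%:R.
  by rewrite /y raddfB /=; congr (_ - _); rewrite -(rmorph_nat (real_complex R)).
have yk : k.+1%:R <= `|Re y|.
  by rewrite Ry ler0_norm; have : (0 : R) <= k.+1%:R by []; lra.
have y0 : y != 0.
  apply/eqP => E; move: yk; rewrite E /= normr0.
  by have : (0 : R) < k.+1%:R by []; lra.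
have -> : z - k%:R = y + 1.
  by rewrite /y -natr1 opprD addrA subrK.
have kY : k.+1%:R <= cnorm y := le_trans yk (Re_le_cnorm y).
have GF : 0 <= cnorm (Gamma y) * k`!%:R by rewrite mulr_ge0 ?cnorm_ge0.
rewrite Gamma_feq// cnormM factS natrM mulrCA -[leRHS]mulrA.
exact: ler_wpM2r.
Qed.

(** The factorial of one factor is kept and the other factors merely do not grow; a single [k!]
    already outweighs [u^k]. *)
Lemma gamma_product_shift_bound n (p : 'I_n -> R) z (k : nat) : (0 < n)%N ->
  (forall m, Re z + p m < 0) ->
  cnorm (gamma_product p (z - k%:R)) <= cnorm (gamma_product p z) / k`!%:R.
Proof.
move=> n0 zp; have F0 : 0 < k`!%:R :> R by rewrite ltr0n fact_gt0.
have F1 : 1 <= k`!%:R :> R by rewrite ler1n fact_gt0.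
rewrite ler_pdivlMr// /gamma_product (bigD1 (Ordinal n0))//= [X in _ <= cnorm X](bigD1 (Ordinal n0))//=.
have H m : cnorm (Gamma (z - k%:R + (p m)%:C)) * k`!%:R <= cnorm (Gamma (z + (p m)%:C)).
  have := @Gamma_shift_bound (z + (p m)%:C) k; rewrite raddfD /= => /(_ (zp m)).
  by rewrite addrAC.
rewrite !cnormM mulrAC; apply: ler_pM; rewrite ?mulr_ge0 ?cnorm_ge0//.
apply: (big_ind2 (fun u v : R[i] => cnorm u <= cnorm v)) => // [a b c e h1 h2|m _].
  by rewrite !cnormM ler_pM// cnorm_ge0.
apply: le_trans (H m); rewrite ler_peMr ?cnorm_ge0//.
Qed.

Lemma Re_CInt_le_cnorm (P Q : R -> R[i]) (a : R) b : CL1 P -> CL1 Q -> 0 <= b ->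
  (forall t, cnorm (P t) <= b * cnorm (Q t)) ->
  `|Re (CInt (fun t => P t * cis (a * t)))| <=
     b * (Int (fun t => `|Re (Q t)| + `|Im (Q t)|) *+ 2).
Proof.
move=> lP lQ b0 PQ; apply: (le_trans (CInt_inv_bound a 0 lP)).
have [p1 p2] := lP; have [q1 q2] := lQ.
have lQQ : L1 (fun t => `|Re (Q t)| + `|Im (Q t)|) by apply: L1D; exact: L1_norm.
rewrite -mulr_natl mulrA -IntZ//; apply: le_Int; [by apply: L1D; exact: L1_norm|exact: L1Z|].
move=> t; rewrite -mulrA [leRHS]mulrCA mulr_natl mulr2n.
have h := le_trans (PQ t) (ler_wpM2l b0 (cnorm_le (Q t))).
by apply: lerD; [exact: le_trans (Re_le_cnorm _) h|exact: le_trans (Im_le_cnorm _) h].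
Qed.

(** If every [c + p m] is negative and not an integer, then all lines [c - k] avoid the poles, and
    each unit step passes exactly one pole of each factor. *)
Lemma exists_generic n (p : 'I_n -> R) : exists c, exists K : 'I_n -> nat,
  forall m, (c + p m < 0) /\ forall k : nat, strip (K m + k) (c - k%:R + p m).
Proof.
pose a := - (\sum_(m < n) `|p m|) - 1.
have ap m : a + p m < 0.
  have : p m <= \sum_(m < n) `|p m|.
    rewrite (bigD1 m)//= (le_trans (ler_norm _))// lerDl sumr_ge0//.
  by rewrite /a; lra.
pose f m := Num.floor (a + p m).
have f1 m : (f m)%:~R <= a + p m by exact: floor_le.
have f2 m : a + p m < (f m)%:~R + 1 by rewrite -intrD1; exact: floorD1_gt.
have fn m : (f m < 0)%R by rewrite floor_lt_int.
(* A positive shift that takes every [a + p m] off the integers without reaching the next one. *)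
have [|d /andP[d0 d1] db] := @exists_below n (fun m => (f m)%:~R + 1 - (a + p m)).
  by move=> m; rewrite subr_gt0.
have fE m : ((`|f m|%N)%:R : R) = - (f m)%:~R.
  by rewrite natr_absz ltr0_norm// mulrNz.
exists (a + d), (fun m => `|f m|%N) => m; have := db m; have := f1 m; have := f2 m.
have fm1 : (f m)%:~R <= -1 :> R.
  by rewrite -[-1]/((-1)%:~R) ler_int -ltzD1 addNr.
move=> h1 h2 h3; split; first by lra.
move=> k; rewrite /strip natrD fE; apply/andP; split; first by lra.
by apply/orP; right; lra.
Qed.

(** The bound [A] is the one for [k = 0]: on the line [c - k] the prefactor gains [exp (k x)] and
    the integrand loses [k!]. The integral is real because it equals the value of a real function,
    though one depending on [k]. *)
Lemma inversion_shift_bound n (p : 'I_n -> R) (K : 'I_n -> nat) c x : (0 < n)%N ->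
  (forall m, (c + p m < 0) /\ forall k : nat, strip (K m + k) (c - k%:R + p m)) ->
  exists A : R, exists r : nat -> R, forall k : nat,
    inversion (gamma_product p) (c - k%:R) x = (r k)%:C /\
    `|r k| <= A * (expR x ^+ k / k`!%:R).
Proof.
move=> n0 H.
have e0 : enum 'I_n != [::] by rewrite -size_eq0 size_enum_ord -lt0n.
have pr (k : nat) : exists h : R -> R, mellin_pair h (gamma_product p) (fun c => forall j, strip (K j + k) (c + p j)).
  have [h hP] := gamma_product_pair p (fun m => K m + k)%N e0; exists h.
  apply: (mellin_pair_sub hP); last by move=> c' Hc j _; exact: Hc.
  by move=> z; rewrite /gamma_product big_enum.
have [h0 hP0] := pr 0%N.
have [_ _ l0 _] := hP0 c (fun j => eq_ind _ (fun c => strip (K j + 0) (c + p j)) ((H j).2 0%N) _ (subr0 c)).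
pose A := expR (- (c * x)) / (pi *+ 2) * (Int (fun t => `|Re (gamma_product p (c +i* t))| + `|Im (gamma_product p (c +i* t))|) *+ 2).
exists A; exists (fun k => Re (inversion (gamma_product p) (c - k%:R) x)) => k.
have [h hP] := pr k; have Sk j := (H j).2 k.
have [_ _ lk _] := hP _ Sk.
rewrite (mellin_pair_inversion x hP Sk); split => //=.
have -> : h x = Re (inversion (gamma_product p) (c - k%:R) x) by rewrite (mellin_pair_inversion x hP Sk).
rewrite /inversion ReM /= mul0r subr0 normrM.
have F0 : 0 < k`!%:R :> R by rewrite ltr0n fact_gt0.
have pi0 : 0 < pi *+ 2 :> R by rewrite mulrn_wgt0 ?pi_gt0.
have := @Re_CInt_le_cnorm _ _ (- x) (k`!%:R^-1) lk l0.
rewrite invr_ge0 ltW// => /(_ isT) B.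
have {}B := B _; rewrite ger0_norm; last by rewrite divr_ge0 ?expR_ge0 ?ltW.
apply: (@le_trans _ _ (expR (- ((c - k%:R) * x)) / (pi *+ 2) * (k`!%:R^-1 * (Int (fun t => `|Re (gamma_product p (c +i* t))| + `|Im (gamma_product p (c +i* t))|) *+ 2)))).
  apply: ler_wpM2l; first by rewrite divr_ge0 ?expR_ge0 ?ltW.
  apply: B => t.
  rewrite mulrC; have := @gamma_product_shift_bound n p (c +i* t) k n0 (fun m => (H m).1).
  rewrite (_ : c +i* t - k%:R = (c - k%:R) +i* t)//.
  by rewrite -(rmorph_nat (real_complex R)); apply: complex_ext; rewrite //= subr0.
rewrite /A expR_natpow mulrBl opprB expRD le_eqVlt; apply/orP; left; apply/eqP; ring.
Qed.

(** * The reflection formula *)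

Definition rGamma a : R := Re (Gamma a%:C).

Lemma hat_at0 f : hat f 0 = (Int f)%:C.
Proof.
by rewrite /hat -CInt_real; congr (CInt _); apply/funext => y; rewrite mul0r cis0 mulr1.
Qed.

Lemma Gamma_real a : Gamma a%:C = (rGamma a)%:C.
Proof.
have E (b : R) : 0 < b -> euler_integral b%:C = (Int (wtail 0 b))%:C.
  by move=> b0; rewrite -[b%:C]/(b +i* 0) euler_integral_hat// hat_at0.
suff [r Er] : exists r : R, Gamma a%:C = r%:C by rewrite /rGamma Er.
rewrite /Gamma /=; case: ifPn => [a0|]; first by eexists; exact: E.
rewrite -leNgt => a0; set N := Num.truncn _.
have aN : 0 < a + N.+1%:R.
  have : `|a| < N.+1%:R by exact: truncnS_gt.
  by rewrite ler0_norm//; lra.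
rewrite -(rmorph_nat (real_complex R)) -rmorphD E//.
rewrite (_ : \prod_(k < N.+1) (a%:C + k%:R) = (\prod_(k < N.+1) (a + k%:R))%:C).
  by rewrite -fmorphV -rmorphM; eexists.
rewrite rmorph_prod; apply: eq_bigr => i _.
by rewrite rmorphD rmorph_nat.
Qed.

Lemma rGamma_feq a : a != 0 -> rGamma (a + 1) = a * rGamma a.
Proof.
move=> a0; have az : a%:C != 0 by rewrite eq_complex /= negb_and a0.
have := Gamma_feq az; rewrite (_ : a%:C + 1 = (a + 1)%:C); last by rewrite rmorphD.
by rewrite !Gamma_real -rmorphM => /complexI.
Qed.

Lemma strip0 a : 0 < a -> strip 0 a.
Proof. by rewrite /strip oppr0 orTb andbT. Qed.

Lemma rGamma_Int a : 0 < a -> rGamma a = Int (wtail 0 a).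
Proof.
move=> a0; apply: (@complexI R); rewrite -Gamma_real.
by rewrite -[a%:C]/(a +i* 0) -(hat_wtail_Gamma 0 (strip0 a0)) hat_at0.
Qed.

Lemma wtail0E a x : wtail 0 a x = expR (a * x) * expR (- expR x).
Proof. by rewrite /wtail exp_tail0. Qed.

Lemma rGamma1 : rGamma 1 = 1.
Proof.
rewrite rGamma_Int//; pose F (x : R) := - expR (- expR x).
have dF x : is_derive x 1 F (wtail 0 1 x).
  apply: (is_derive_eq (is_derive1N (is_derive1_exp (is_derive1N (is_derive_expR x))))).
  by rewrite wtail0E mul1r mulNr opprK.
apply: (@Int_FTC _ _ _ _ dF).
- exact: continuous_wtail.
- exact: wtail_L1 (strip0 ltr01).
- rewrite -[X in _ --> X](_ : - 0 - (- 1) = 1 :> R); last by rewrite oppr0 opprK add0r.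
  have h : (fun n : nat => expR (- n%:R)) @ \oo --> (0 : R).
    have := cvg_expN_nat (@ltr01 R).
    by under eq_fun do rewrite mulN1r.
  apply: cvgB; apply: cvgN.
    apply: (@squeeze_cvgr _ _ _ _ (cst 0) (fun n => expR (- n%:R))) => //; last exact: cvg_cst.
    apply: nearW => n; rewrite /= expR_ge0/= ler_expR lerN2.
    by apply: le_trans (expR_ge1Dx _); rewrite lerDr.
  have c : continuous (fun y : R => expR (- y)).
    by apply: continuous_comp1; [exact: continuous_expR|exact: opp_continuous].
  have := continuous_cvg_seq c h.
  by rewrite oppr0 expR0.
Qed.

Lemma rGamma_nat n : rGamma n.+1%:R = n`!%:R.
Proof.
elim: n => [|n IH]; first by rewrite rGamma1 fact0.
by rewrite -natr1 rGamma_feq ?pnatr_eq0// IH factS natrM.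
Qed.

(** The bound [1 + t <= exp t] at [(1 - a) y] and at [- a y], with weights [a] and [1 - a]; the
    linear terms cancel. *)
Lemma expR_convex a y : 0 <= a <= 1 -> expR (a * y) <= 1 - a + a * expR y.
Proof.
move=> /andP[a0 a1].
have h1 : expR (a * y) * (1 + (1 - a) * y) <= expR y.
  apply: (@le_trans _ _ (expR (a * y) * expR ((1 - a) * y))).
    by rewrite ler_wpM2l ?expR_ge0// expR_ge1Dx.
  by rewrite -expRD -mulrDl addrC subrK mul1r.
have h2 : expR (a * y) * (1 - a * y) <= 1.
  apply: (@le_trans _ _ (expR (a * y) * expR (- (a * y)))).
    by rewrite ler_wpM2l ?expR_ge0// expR_ge1Dx.
  by rewrite -expRD subrr expR0.
have h3 := ler_wpM2l a0 h1.
have h4 : (1 - a) * (expR (a * y) * (1 - a * y)) <= (1 - a) * 1 by rewrite ler_wpM2l// subr_ge0.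
have := lerD h4 h3; rewrite mulr1; apply: le_trans.
by rewrite le_eqVlt; apply/orP; left; apply/eqP; ring.
Qed.

(* [expR_convex] at [y = x - l], integrated; optimizing over [l] gives log-convexity. *)
Lemma rGamma_interpolation b a l : 0 < b -> 0 <= a <= 1 ->
  rGamma (b + a) <= expR (a * l) * ((1 - a) * rGamma b + a * expR (- l) * rGamma (b + 1)).
Proof.
move=> b0 a01; have /andP[a0 a1] := a01.
have ba : 0 < b + a by lra.
have b1 : 0 < b + 1 by lra.
rewrite !rGamma_Int//.
have L b' (h : 0 < b') := wtail_L1 (strip0 h).
rewrite -(IntZ (1 - a))//; last exact: L.
rewrite -(IntZ (a * expR (- l)))//; last exact: L.
rewrite -IntD; [|exact: L1Z (L _ b0)|exact: L1Z (L _ b1)].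
rewrite -IntZ; last by apply: L1D; [exact: L1Z (L _ b0)|exact: L1Z (L _ b1)].
apply: le_Int; [exact: L|by apply: L1Z; apply: L1D; [exact: L1Z (L _ b0)|exact: L1Z (L _ b1)]|].
move=> x; rewrite !wtail0E.
have -> : expR ((b + 1) * x) = expR (b * x) * expR x by rewrite -expRD mulrDl mul1r.
have -> : expR ((b + a) * x) = expR (b * x) * (expR (a * l) * expR (a * (x - l))).
  by rewrite -!expRD; congr expR; ring.
have h := expR_convex (x - l) a01.
have -> : expR (a * l) * ((1 - a) * (expR (b * x) * expR (- expR x)) + a * expR (- l) * (expR (b * x) * expR x * expR (- expR x))) =
  expR (b * x) * (expR (a * l) * (1 - a + a * expR (x - l))) * expR (- expR x).
  by rewrite expRD; ring.
by rewrite ler_wpM2r ?expR_ge0// ler_wpM2l ?expR_ge0// ler_wpM2l ?expR_ge0.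
Qed.

(** Under the integral this is [2 <= exp v + exp (- v)] with [v = s + a x]. The best [s] gives
    [rGamma b ^ 2 <= rGamma (b + a) * rGamma (b - a)]. *)
Lemma rGamma_logconvex b a s : 0 < b -> 0 < b - a -> 0 < b + a ->
  rGamma b *+ 2 <= expR s * rGamma (b + a) + expR (- s) * rGamma (b - a).
Proof.
move=> b0 h1 h2; rewrite !rGamma_Int//.
have L b' (h : 0 < b') := wtail_L1 (strip0 h).
rewrite -mulr_natl -!IntZ; [|exact: L..].
rewrite -IntD; [|exact: L1Z (L _ h2)|exact: L1Z (L _ h1)].
apply: le_Int; [exact: L1Z (L _ b0)|by apply: L1D; [exact: L1Z (L _ h2)|exact: L1Z (L _ h1)]|].
move=> x; rewrite !wtail0E.
have -> : expR ((b - a) * x) = expR (b * x) * expR (- (a * x)) by rewrite -expRD; congr expR; ring.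
have -> : expR ((b + a) * x) = expR (b * x) * expR (a * x) by rewrite -expRD; congr expR; ring.
have q : 2 <= expR (s + a * x) + expR (- (s + a * x)).
  have := expR_ge1Dx (s + a * x); have := expR_ge1Dx (- (s + a * x)); lra.
have -> : expR s * (expR (b * x) * expR (a * x) * expR (- expR x)) + expR (- s) * (expR (b * x) * expR (- (a * x)) * expR (- expR x)) =
  (expR (s + a * x) + expR (- (s + a * x))) * (expR (b * x) * expR (- expR x)).
  by rewrite opprD !expRD; ring.
by rewrite ler_wpM2r// mulr_ge0 ?expR_ge0.
Qed.

(** The integer [n + 2] lies between [b] and [b + 1], so interpolation bounds a factorial by a
    positive multiple of [rGamma b]. *)
Lemma rGamma_gt0 n a : 0 <= a <= 1 -> 0 < rGamma (n.+1%:R + a).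
Proof.
move=> /andP[a0 a1]; set b := n.+1%:R + a.
have n1 : (0 : R) <= n%:R by [].
have b1 : 1 <= b by rewrite /b -natr1; lra.
have b0 : 0 < b by lra.
have := @rGamma_interpolation b (1 - a) 0 b0.
rewrite (_ : 0 <= 1 - a <= 1); last by apply/andP; split; lra.
move=> /(_ isT); rewrite !mulr0 oppr0 expR0 mul1r mulr1 rGamma_feq ?gt_eqF//.
rewrite (_ : b + (1 - a) = n.+2%:R); last by rewrite /b -[n.+2%:R]natr1; ring.
rewrite rGamma_nat (_ : _ + _ = (1 - (1 - a) + (1 - a) * b) * rGamma b); last by ring.
have F0 : 0 < (n.+1)`!%:R :> R by rewrite ltr0n fact_gt0.
move=> /(lt_le_trans F0); rewrite pmulr_rgt0//.
have : 0 <= (1 - a) * b by rewrite mulr_ge0//; lra.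
have : (1 - a) * 1 <= (1 - a) * b by rewrite ler_wpM2l//; lra.
lra.
Qed.

Lemma rGamma_prod_le m a : 0 <= a <= 1 ->
  rGamma (m.+2%:R + a) * rGamma (m.+2%:R - a) <= (m.+1)`!%:R ^+ 2 * (1 + m.+1%:R^-1).
Proof.
move=> a01; have /andP[a0 a1] := a01.
have m20 : 0 < m.+2%:R :> R by []. have m10 : 0 < m.+1%:R :> R by [].
(* The optimal choice at [b = m + 2], where [rGamma (b + 1) / rGamma b = m + 2]. The second
   estimate, at [b = m + 1], takes the same [l] so that the two exponentials multiply to [m + 2]. *)
pose l := ln (m.+2%:R : R).
have el : expR l = m.+2%:R by rewrite lnK// posrE.
have eNl : expR (- l) = m.+2%:R^-1 by rewrite expRN el.
have F0 : 0 < m`!%:R :> R by rewrite ltr0n fact_gt0.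
have h1 : rGamma (m.+2%:R + a) <= expR (a * l) * (m.+1)`!%:R.
  have := rGamma_interpolation l m20 a01.
  rewrite natr1 !rGamma_nat eNl (factS m.+1) natrM => /le_trans; apply.
  by rewrite ler_wpM2l ?expR_ge0// le_eqVlt; apply/orP; left; apply/eqP; field.
have h2 : rGamma (m.+2%:R - a) <= expR ((1 - a) * l) * m`!%:R.
  have a01' : 0 <= 1 - a <= 1 by apply/andP; split; lra.
  have := rGamma_interpolation l m10 a01'.
  rewrite natr1 !rGamma_nat eNl (_ : m.+1%:R + (1 - a) = m.+2%:R - a); last by rewrite -[m.+2%:R]natr1; ring.
  move=> /le_trans; apply; rewrite ler_wpM2l ?expR_ge0//.
  rewrite factS natrM.
  have k : (1 - a) / m.+2%:R * (m.+1%:R * m`!%:R) <= (1 - a) * m`!%:R.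
    rewrite -!mulrA ler_wpM2l//; first by lra.
    by rewrite ler_pdivrMl//; apply: ler_wpM2r; [exact: ltW|rewrite ler_nat].
  by apply: (le_trans (lerD (lexx _) k)); rewrite -mulrDl subrK mul1r.
have p2 : 0 <= rGamma (m.+2%:R - a).
  rewrite (_ : m.+2%:R - a = m.+1%:R + (1 - a)); last by rewrite -[m.+2%:R]natr1; ring.
  by rewrite ltW// rGamma_gt0//; apply/andP; split; lra.
apply: (@le_trans _ _ ((expR (a * l) * (m.+1)`!%:R) * (expR ((1 - a) * l) * m`!%:R))).
  by apply: ler_pM => //; rewrite ltW// rGamma_gt0.
rewrite mulrACA -expRD -mulrDl addrC subrK mul1r el.
by rewrite le_eqVlt; apply/orP; left; apply/eqP; rewrite factS natrM -[m.+2%:R]natr1; field.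
Qed.

Lemma rGamma_prod_ge m a : 0 <= a <= 1 ->
  (m.+1)`!%:R ^+ 2 <= rGamma (m.+2%:R + a) * rGamma (m.+2%:R - a).
Proof.
move=> a01; have /andP[a0 a1] := a01.
have mm : (0 : R) <= m%:R by [].
have m20 : 0 < m.+2%:R :> R by [].
set A := rGamma (_ + a); set B := rGamma (_ - a); set F : R := (m.+1)`!%:R.
have A0 : 0 < A by exact: rGamma_gt0.
have F0 : 0 < F by rewrite ltr0n fact_gt0.
(* This [s] makes the first term equal to [F], which leaves [F <= A * B / F]. *)
have := @rGamma_logconvex m.+2%:R a (ln (F / A)) m20.
rewrite rGamma_nat -/A -/B -/F.
rewrite -[m.+2%:R]natr1 -[m.+1%:R]natr1.
rewrite expRN lnK ?posrE ?divr_gt0//.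
move=> H; have {}H := H _ _.
have : F *+ 2 <= F / A * A + (F / A)^-1 * B by apply: H; lra.
rewrite divfK ?gt_eqF// mulr2n lerD2l invf_div => h.
by move: (ler_wpM2r (ltW F0) h); rewrite -expr2 mulrAC divfK ?gt_eqF// mulrC.
Qed.

(** The partial products of Euler's product for [sin (pi a) / (pi a)]. *)
Definition euler_prod a k := \prod_(i < k) (1 - a ^+ 2 / i.+1%:R ^+ 2).

Lemma rGamma_prodE k a : 0 < a < 1 ->
  rGamma (k.+1%:R + a) * rGamma (k.+1%:R - a) =
  k`!%:R ^+ 2 * euler_prod a k * (rGamma (1 + a) * rGamma (1 - a)).
Proof.
move=> /andP[a0 a1]; elim: k => [|k IH].
  by rewrite /euler_prod big_ord0 fact0 expr1n !mul1r.
have kk : (0 : R) <= k%:R by [].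
have k10 : k.+1%:R != 0 :> R by rewrite pnatr_eq0.
rewrite -[k.+2%:R]natr1.
have -> : k.+1%:R + 1 + a = (k.+1%:R + a) + 1 :> R by ring.
have -> : k.+1%:R + 1 - a = (k.+1%:R - a) + 1 :> R by ring.
rewrite !rGamma_feq; first last.
- by rewrite gt_eqF// -natr1; lra.
- by rewrite gt_eqF// -natr1; lra.
rewrite mulrACA IH /euler_prod big_ord_recr /= factS natrM.
by move: (k.+1%:R : R) (k`!%:R : R) k10 (\prod_(i < k) _ ) => x y x0 w; field.
Qed.

(** * Integrals of powers of the cosine *)

Notation SI f := (\int[mu]_(t in `[0, pi / 2]) f t).

Lemma SI_integrable f : continuous f -> mu.-integrable `[0, pi / 2] (EFin \o f).
Proof.
move=> cf; apply: continuous_compact_integrable; first exact: segment_compact.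
exact: continuous_subspaceT.
Qed.

Lemma SI_FTC F f : continuous f -> (forall x, is_derive x 1 F (f x)) ->
  SI f = F (pi / 2) - F 0.
Proof.
move=> cf dF; rewrite /Rintegral (integral_segment_FTC _ cf dF)//.
by rewrite divr_ge0// pi_ge0.
Qed.

Lemma le_SI f g : continuous f -> continuous g ->
  (forall t, 0 <= t <= pi / 2 -> f t <= g t) -> SI f <= SI g.
Proof.
move=> cf cg fg; apply: le_Rintegral; [by []|exact: SI_integrable|exact: SI_integrable|].
by move=> t /=; rewrite in_itv/=; exact: fg.
Qed.

Lemma SIB f g : continuous f -> continuous g -> SI (fun t => f t - g t) = SI f - SI g.
Proof.
by move=> cf cg; rewrite RintegralB//; exact: SI_integrable.
Qed.

Lemma SIZ c f : continuous f -> SI (fun t => c * f t) = c * SI f.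
Proof. by move=> cf; rewrite RintegralZl//; exact: SI_integrable. Qed.

Definition cosint k a := SI (fun t => cos t ^+ k.*2 * cos (2 * a * t)).

Lemma continuous_cosX k : continuous (fun t : R => cos t ^+ k).
Proof. by apply: (@continuous_comp1 (fun y => y ^+ k)); [exact: exprn_continuous|exact: continuous_cos]. Qed.

Lemma continuous_cosint k a : continuous (fun t : R => cos t ^+ k * cos (2 * a * t)).
Proof. by apply: continuous_mul; [exact: continuous_cosX|exact: continuous_coslin]. Qed.

Lemma cosint_rec k a : (k.+1%:R ^+ 2 - a ^+ 2) * cosint k.+1 a *+ 4 =
  (k.*2.+2 * k.*2.+1)%:R * cosint k a.
Proof.
set m := k.*2.+2%N.
(* The Wronskian of [cos t ^ m] and [cos (2 a t)]. It vanishes at both ends, so that integrating its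
   derivative amounts to two integrations by parts. *)
pose F (t : R) := m%:R * (cos t ^+ m.-1 * (sin t * cos (2 * a * t))) - (2 * a) * (cos t ^+ m * sin (2 * a * t)).
pose f (t : R) := (m%:R ^+ 2 - 4 * a ^+ 2) * (cos t ^+ m * cos (2 * a * t)) -
   (m * m.-1)%:R * (cos t ^+ k.*2 * cos (2 * a * t)).
have dF t : is_derive t 1 F (f t).
  have l := is_derive1_lin (2 * a) t.
  have dc := is_derive_cos t; have ds := is_derive_sin t.
  apply: (is_derive_eq (is_derive1D (is_derive1Z m%:R (is_derive1M (is_derive1X m.-1 dc) (is_derive1M ds (is_derive1_cosf l))))
    (is_derive1N (is_derive1Z (2 * a) (is_derive1M (is_derive1X m dc) (is_derive1_sinf l)))))).
  rewrite /f /m /= !exprS natrM -[k.*2.+2%:R]natr1.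
  have e := sin2cos2 t; move: e; rewrite !expr2 => e.
  move: (cos t ^+ k.*2) (cos (2 * a * t)) (sin (2 * a * t)) (k.*2.+1%:R : R) => X Y Z M.
  move: (cos t) (sin t) e => C S e.
  transitivity ((M + 1) * ((M * X * - (S * S)) * Y + (C * X) * (C * Y)) -  (2 * a) * (C * (C * X)) * (2 * a * Y)); first by ring.
  by rewrite e; ring.
have cc (r : R) i : continuous (fun t : R => r * (cos t ^+ i * cos (2 * a * t))).
  by apply: continuous_mul; [move=> ?; exact: cvg_cst|exact: continuous_cosint].
have cf : continuous f.
  by apply: continuous_add; [exact: cc|move=> t; apply: cvgN; exact: cc].
have F1 : F (pi / 2) = 0 by rewrite /F /m /= !exprS cos_pihalf !(mul0r, mulr0, subr0).
have F0 : F 0 = 0 by rewrite /F mulr0 sin0 !(mul0r, mulr0, subr0).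
have := SI_FTC cf dF; rewrite F1 F0 subr0.
rewrite /f SIB; [|exact: cc|exact: cc].
rewrite !SIZ; [|exact: continuous_cosint..].
rewrite -/(cosint k a) -/(cosint k.+1 a) => /eqP; rewrite subr_eq0 => /eqP <-.
by rewrite /m -[k.*2.+2]/(k.+1.*2) -mul2n natrM -mulr_natl; ring.
Qed.

Lemma cosint_step k a :
  cosint k.+1 a * (1 - a ^+ 2 / k.+1%:R ^+ 2) = k.*2.+1%:R / k.*2.+2%:R * cosint k a.
Proof.
have k0 : k.+1%:R != 0 :> R by rewrite pnatr_eq0.
have H := cosint_rec k a.
have E : (k.*2.+2)%:R = 2 * k.+1%:R :> R by rewrite -[k.*2.+2]/(k.+1.*2) -mul2n natrM.
move: H; rewrite natrM E.
move: (k.+1%:R : R) k0 (k.*2.+1%:R : R) (cosint k.+1 a) (cosint k a) => x x0 y I1 I0 H.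
have two0 : 2 != 0 :> R by rewrite pnatr_eq0.
apply: (mulfI (mulf_neq0 two0 (mulf_neq0 x0 two0))); apply: (mulfI x0).
transitivity ((x ^+ 2 - a ^+ 2) * I1 *+ 4); first by field.
by rewrite H; field.
Qed.

(** The recurrence telescopes. Since [cosint 0 a / cosint 0 0] is [sin (pi a) / (pi a)], this is
    Euler's product with the exact remainder [cosint k a / cosint k 0]. *)
Lemma cosint_ratio k a : cosint k a * euler_prod a k * cosint 0 0 = cosint k 0 * cosint 0 a.
Proof.
elim: k => [|k IH]; first by rewrite /euler_prod big_ord0 mulr1 mulrC.
have H := cosint_step k 0; rewrite expr0n mul0r subr0 mulr1 in H.
rewrite H /euler_prod big_ord_recr /= -/(euler_prod a k).
rewrite -[RHS]mulrA -IH mulrCA mulrA mulrA (mulrA _ (cosint k a)) -cosint_step; ring.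
Qed.

Lemma cosint00 : cosint 0 0 = pi / 2.
Proof.
have d t : is_derive t 1 (fun t : R => 1 * t) (cos t ^+ 0.*2 * cos (2 * 0 * t)).
  apply: (is_derive_eq (is_derive1_lin 1 t)).
  by rewrite expr0 mulr0 mul0r cos0 mulr1.
by rewrite /cosint (SI_FTC (@continuous_cosint _ _) d) mulr0 mul1r subr0.
Qed.

Lemma cosint0 a : a != 0 -> cosint 0 a = sin (pi * a) / (2 * a).
Proof.
move=> a0.
have d t : is_derive t 1 (fun t : R => (2 * a)^-1 * sin (2 * a * t)) (cos t ^+ 0.*2 * cos (2 * a * t)).
  apply: (is_derive_eq (is_derive1Z _ (is_derive1_sinf (is_derive1_lin (2 * a) t)))).
  by rewrite expr0 mul1r mulrA mulVf ?mul1r// mulf_neq0// pnatr_eq0.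
rewrite /cosint (SI_FTC (@continuous_cosint _ _) d) mulr0 sin0 mulr0 subr0 mulrC.
by congr (sin _ / _); field.
Qed.

Lemma cosint0_gt0 k : 0 < cosint k 0.
Proof.
elim: k => [|k IH]; first by rewrite cosint00 divr_gt0// pi_gt0.
have H := cosint_step k 0; rewrite expr0n mul0r subr0 mulr1 in H.
by rewrite H mulr_gt0// divr_gt0.
Qed.

Lemma cosint_gt0 k a : 0 < a < 1 -> 0 < cosint k a.
Proof.
move=> /andP[a0 a1]; elim: k => [|k IH].
  rewrite cosint0 ?gt_eqF// divr_gt0//; last by rewrite mulr_gt0.
  by rewrite sin_gt0_pi// mulr_gt0 ?pi_gt0//= gtr_pMr ?pi_gt0.
have k1 : 1 <= k.+1%:R ^+ 2 :> R by rewrite exprn_ege1// ler1n.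
have d : 0 < 1 - a ^+ 2 / k.+1%:R ^+ 2.
  rewrite subr_gt0 ltr_pdivrMr ?(lt_le_trans _ k1)// mul1r (lt_le_trans _ k1)//.
  by rewrite exprn_ilt1// ltW.
by rewrite -(pmulr_lgt0 _ d) cosint_step mulr_gt0// divr_gt0.
Qed.

Lemma sin_sqr_le y : 0 <= y -> sin y ^+ 2 <= y ^+ 2.
Proof.
move=> y0; have [|c _] := @MVT_segment _ (@sin R) (@cos R) 0 y y0.
  by apply: continuous_subspaceT; exact: continuous_sin.
rewrite sin0 !subr0 => ->; rewrite exprMn ler_piMl ?sqr_ge0//.
Qed.

Lemma mul_cos_le_sin t : 0 <= t <= pi / 2 -> t * cos t <= sin t.
Proof.
move=> /andP[t0 t1].
pose g (t : R) := sin t - t * cos t.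
have dg x : is_derive x 1 g (x * sin x).
  apply: (is_derive_eq (is_derive1D (is_derive_sin x) (is_derive1N (is_derive1M (is_derive_id x 1) (is_derive_cos x))))).
  by rewrite /=; ring.
have [|c] := @MVT_segment _ g (fun x => x * sin x) 0 t t0.
  by apply: continuous_subspaceT; exact: continuous_of_derive dg.
rewrite in_itv/= => /andP[c0 ct]; rewrite {2}/g sin0 mul0r !subr0 => E.
rewrite -subr_ge0 -/(g t) E mulr_ge0// mulr_ge0// sin_ge0_pi// c0/=.
by rewrite (le_trans ct)// (le_trans t1)// ler_pdivrMr// ler_peMr ?pi_ge0// ler1n.
Qed.

Lemma cosint_le k a : cosint k a <= cosint k 0.
Proof.
apply: le_SI; [exact: continuous_cosint|exact: continuous_cosint|].
move=> t _; rewrite mulr0 mul0r cos0 ler_wpM2l ?cos_le1// -muln2 exprM sqr_ge0//.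
Qed.

(** Pointwise, [1 - cos (2 a t) = 2 sin (a t) ^ 2 <= 2 a^2 t^2], and [t cos t <= sin t] absorbs
    [t^2] into one factor [cos t ^ 2]. *)
Lemma cosint_gap k a : 0 <= a ->
  cosint k.+1 0 - cosint k.+1 a <= 2 * a ^+ 2 * (cosint k 0 - cosint k.+1 0).
Proof.
move=> a0; rewrite /cosint -!SIB; try exact: continuous_cosint.
have cB (f g : R -> R) : continuous f -> continuous g -> continuous (fun t => f t - g t).
  by move=> cf cg t; apply: cvgB; [exact: cf|exact: cg].
rewrite -SIZ; last by apply: cB; exact: continuous_cosint.
apply: le_SI.
- by apply: cB; exact: continuous_cosint.
- apply: continuous_mul; first by move=> ?; exact: cvg_cst.
  by apply: cB; exact: continuous_cosint.
move=> t /andP[t0 t1]; rewrite mulr0 !mul0r cos0 doubleS !exprS !mulr1.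
have X0 : 0 <= cos t ^+ k.*2 by rewrite -muln2 exprM sqr_ge0.
have -> : cos (2 * a * t) = 1 - 2 * sin (a * t) ^+ 2.
  rewrite -mulrA mulr_natl cos_mulr2n cos2sin2 -mulr_natl; ring.
have h1 := sin_sqr_le (mulr_ge0 a0 t0).
have h2 : (t * cos t) ^+ 2 <= sin t ^+ 2.
  have ct : 0 <= cos t by rewrite cos_ge0_pihalf// t1 andbT (le_trans _ t0)// oppr_le0 divr_ge0 ?pi_ge0.
  rewrite ler_sqr ?nnegrE ?mulr_ge0//; first by rewrite mul_cos_le_sin// t0.
  by apply: le_trans (mul_cos_le_sin _); rewrite ?mulr_ge0// t0.
rewrite sin2cos2 in h2.
move: (cos t) (cos t ^+ k.*2) X0 h2 (sin (a * t)) h1 => C X X0 h2 S h1.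
have h3 : C ^+ 2 * S ^+ 2 <= a ^+ 2 * (1 - C ^+ 2).
  apply: (@le_trans _ _ (C ^+ 2 * (a * t) ^+ 2)); first by rewrite ler_wpM2l ?sqr_ge0.
  have -> : C ^+ 2 * (a * t) ^+ 2 = a ^+ 2 * (t * C) ^+ 2 by ring.
  by rewrite ler_wpM2l ?sqr_ge0.
have := ler_wpM2l X0 h3.
have -> : C * (C * X) - C * (C * X) * (1 - 2 * S ^+ 2) = 2 * (X * (C ^+ 2 * S ^+ 2)) by ring.
have -> : 2 * a ^+ 2 * (X - C * (C * X)) = 2 * (X * (a ^+ 2 * (1 - C ^+ 2))) by ring.
by move=> h; rewrite ler_pM2l.
Qed.

Lemma reflection01 a : 0 < a < 1 -> rGamma a * rGamma (1 - a) * sin (pi * a) = pi.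
Proof.
move=> a01; have /andP[a0 a1] := a01.
have a01' : 0 <= a <= 1 by rewrite !ltW.
have na0 : a != 0 by rewrite gt_eqF.
pose C := rGamma (1 + a) * rGamma (1 - a).
(* The claim amounts to [X = 1]. By [XE], [X] is for every [k] a product of two quotients, one of
   Gamma values by [k! ^ 2] and one of cosine integrals, which both tend to 1. *)
pose X := C * sin (pi * a) / (pi * a).
have XE k : X * (k`!%:R ^+ 2 * cosint k 0) = rGamma (k.+1%:R + a) * rGamma (k.+1%:R - a) * cosint k a.
  have F0 : k`!%:R != 0 :> R by rewrite pnatr_eq0 -lt0n fact_gt0.
  rewrite rGamma_prodE// -/C.
  have := cosint_ratio k a; rewrite cosint00 cosint0// => H.
  have pi0 : pi != 0 :> R by rewrite gt_eqF// pi_gt0.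
  have two0 : 2 != 0 :> R by rewrite pnatr_eq0.
  apply: (mulfI (mulf_neq0 pi0 (invr_neq0 two0))).
  transitivity (C * k`!%:R ^+ 2 * (cosint k 0 * (sin (pi * a) / (2 * a)))).
    by rewrite /X; move: (sin (pi * a)) (pi : R) pi0 => S q q0; field; rewrite q0 na0.
  by rewrite -H; ring.
have up m : X <= 1 + m.+1%:R^-1.
  have F0 : 0 < (m.+1)`!%:R ^+ 2 :> R by rewrite exprn_gt0// ltr0n fact_gt0.
  have I0 := cosint0_gt0 m.+1.
  rewrite -(ler_pM2r (mulr_gt0 F0 I0)) XE.
  apply: (@le_trans _ _ ((m.+1)`!%:R ^+ 2 * (1 + m.+1%:R^-1) * cosint m.+1 0)).
    apply: (@le_trans _ _ (rGamma (m.+2%:R + a) * rGamma (m.+2%:R - a) * cosint m.+1 0)).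
      rewrite ler_wpM2l ?cosint_le//; apply: le_trans (rGamma_prod_ge m a01'); exact: ltW.
    by apply: ler_wpM2r; [exact: ltW|exact: rGamma_prod_le].
  by rewrite le_eqVlt; apply/orP; left; apply/eqP; ring.
have low m : 1 - 2 * a ^+ 2 * m.+1%:R^-1 <= X.
  have F0 : 0 < (m.+1)`!%:R ^+ 2 :> R by rewrite exprn_gt0// ltr0n fact_gt0.
  have I0 := cosint0_gt0 m.+1.
  have m10 : 0 < m.+1%:R :> R by [].
  rewrite -(ler_pM2r (mulr_gt0 F0 I0)) XE.
  have g : (1 - 2 * a ^+ 2 * m.+1%:R^-1) * cosint m.+1 0 <= cosint m.+1 a.
    have h := cosint_gap m (ltW a0).
    have H := cosint_step m 0; rewrite expr0n mul0r subr0 mulr1 in H.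
    (* By the recurrence at [a = 0] the difference is [cosint m 0 / (2 m + 2)], and [cosint m.+1 0]
       is at least half of [cosint m 0]. *)
    have d : cosint m 0 - cosint m.+1 0 <= m.+1%:R^-1 * cosint m.+1 0.
      have E1 : m.*2.+2%:R = 2 * m.+1%:R :> R by rewrite -[m.*2.+2]/(m.+1.*2) -mul2n natrM.
      have E2 : m.*2.+1%:R = 2 * m.+1%:R - 1 :> R by rewrite -E1 -[m.*2.+2%:R]natr1 addrK.
      have I1 := cosint0_gt0 m.
      rewrite H E1 E2.
      have mm : (1 : R) <= m.+1%:R by rewrite ler1n.
      move: (m.+1%:R : R) m10 mm (cosint m 0) I1 => x x0 x1 I I1.
      have -> : I - (2 * x - 1) / (2 * x) * I = I / (2 * x) by field; rewrite gt_eqF.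
      have -> : x^-1 * ((2 * x - 1) / (2 * x) * I) = I / (2 * x) * ((2 * x - 1) / x) by field; rewrite gt_eqF.
      apply: ler_peMr; first by rewrite divr_ge0// ?mulr_ge0// ltW.
      by rewrite ler_pdivlMr// mul1r; lra.
    have := ler_wpM2l (mulr_ge0 (ler0n R 2) (sqr_ge0 a)) d.
    move=> /(le_trans h).
    have -> : (1 - 2 * a ^+ 2 * m.+1%:R^-1) * cosint m.+1 0 = cosint m.+1 0 - 2 * a ^+ 2 * (m.+1%:R^-1 * cosint m.+1 0) by ring.
    by move=> hh; rewrite lerBlDr -lerBlDl; exact: hh.
  rewrite mulrCA; apply: (@le_trans _ _ ((m.+1)`!%:R ^+ 2 * cosint m.+1 a)).
    by apply: ler_wpM2l => //; exact: ltW.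
  by apply: ler_wpM2r; [rewrite ltW// cosint_gt0|exact: rGamma_prod_ge].
have lim1 : X = 1.
  have h : (fun m : nat => m.+1%:R^-1) @ \oo --> (0 : R) by exact: cvg_harmonic.
  have l1 : (fun m : nat => 1 - 2 * a ^+ 2 * m.+1%:R^-1) @ \oo --> (1 : R).
    rewrite -[X in _ --> X](_ : 1 - 2 * a ^+ 2 * 0 = 1); last by rewrite mulr0 subr0.
    by apply: cvgB; [exact: cvg_cst|apply: cvgM; [exact: cvg_cst|exact: h]].
  have l2 : (fun m : nat => 1 + m.+1%:R^-1) @ \oo --> (1 : R).
    by rewrite -[X in _ --> X]addr0; apply: cvgD; [exact: cvg_cst|exact: h].
  have : (fun _ : nat => X) @ \oo --> (1 : R).
    apply: (squeeze_cvgr _ l1 l2); apply: nearW => m.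
    by rewrite low up.
  have h2 : (fun _ : nat => X) @ \oo --> X by exact: cvg_cst.
  by move=> h3; exact: (cvg_unique _ h2 h3).
move: lim1; rewrite /X /C addrC rGamma_feq// => lim1.
have pi0 : pi != 0 :> R by rewrite gt_eqF// pi_gt0.
have : pi * a * (a * rGamma a * rGamma (1 - a) * sin (pi * a) / (pi * a)) = pi * a * 1 by rewrite lim1.
rewrite mulrCA divff ?mulf_neq0// !mulr1 -!mulrA [pi * a]mulrC => /(mulfI na0).
by rewrite !mulrA.
Qed.

(** The two functional equations contribute [a] and [- 1 / a], and the sine changes sign. It extends
    [reflection01] from the fractional part to all non-integers. *)
Lemma reflection_shift a : a != 0 -> rGamma (1 + a) * rGamma (1 - (1 + a)) * sin (pi * (1 + a)) =
  rGamma a * rGamma (1 - a) * sin (pi * a).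
Proof.
move=> a0; rewrite addrC rGamma_feq// (_ : 1 - (a + 1) = - a); last by ring.
rewrite (_ : 1 - a = - a + 1); last by ring.
rewrite rGamma_feq ?oppr_eq0// mulrDr mulr1 sinDpi; ring.
Qed.

Lemma reflection a : a \isn't a Num.int -> rGamma a * rGamma (1 - a) * sin (pi * a) = pi.
Proof.
move=> ia.
have ni (b : R) (m : int) : b \isn't a Num.int -> b + m%:~R != 0.
  move=> ib; apply: contra ib; rewrite addr_eq0 => /eqP ->.
  by rewrite rpredN intr_int.
have [b [b01 [m ->]]] : exists b : R, 0 < b < 1 /\ exists m : int, a = b + m%:~R.
  exists (a - (Num.floor a)%:~R); split; last by exists (Num.floor a); rewrite subrK.
  have h1 : (Num.floor a)%:~R <= a by exact: floor_le.
  have h2 : a < (Num.floor a)%:~R + 1 by rewrite -intrD1; exact: floorD1_gt.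
  apply/andP; split; last by lra.
  rewrite lt_neqAle; apply/andP; split; last by lra.
  by rewrite eq_sym; have := ni a (- Num.floor a) ia; rewrite mulrNz.
have ib : b \isn't a Num.int.
  apply/negP => /intrP[k E]; move: b01; rewrite E ltr0z ltrz1 => /andP[k0 k1].
  by move: k0; rewrite ltNge -ltzD1 add0r k1.
case: m => [m|m].
  rewrite -pmulrn; elim: m => [|m IH]; first by rewrite addr0 reflection01.
  rewrite -natr1 (_ : b + (m%:R + 1) = 1 + (b + m%:R)); last by ring.
  by rewrite reflection_shift// pmulrn ni.
rewrite NegzE mulrNz -pmulrn; elim: m => [|m IH].
  rewrite -reflection_shift; last by have := ni b (-1) ib; rewrite mulrN1z.
  by rewrite addrC subrK reflection01.
rewrite -reflection_shift; last by have := ni b (- m.+2%:Z) ib; rewrite mulrNz -pmulrn.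
by rewrite (_ : 1 + (b - m.+2%:R) = b - m.+1%:R)// -[m.+2%:R]natr1; ring.
Qed.

Lemma rGamma_neq0 a : a \isn't a Num.int -> rGamma a != 0.
Proof.
move=> /reflection H; apply/eqP => E; move: H; rewrite E !mul0r => /esym/eqP.
by rewrite gt_eqF// pi_gt0.
Qed.

(** * The residue series *)

(** Once [q] exceeds [|a|], the functional equation multiplies by at least 1; the finitely many
    earlier values are nonzero. The bound lets the exponential series dominate the residue
    series. *)
Lemma rGamma_lower a : a \isn't a Num.int ->
  exists2 B : R, 0 < B & forall q : nat, B <= `|rGamma (1 + q%:R + a)|.
Proof.
move=> ia.
have ni (q : nat) : 1 + q%:R + a \isn't a Num.int.
  apply: contra ia => iq; rewrite -(addKr (1 + q%:R) a).
  by rewrite rpredD// rpredN rpredD// ?rpred1 ?rpred_nat.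
have f0 (q : nat) : 0 < `|rGamma (1 + q%:R + a)| by rewrite normr_gt0 rGamma_neq0.
have initial (Q : nat) : exists2 B : R, 0 < B & forall q : nat, (q <= Q)%N -> B <= `|rGamma (1 + q%:R + a)|.
  elim: Q => [|Q [B B0 IH]].
    by exists `|rGamma (1 + 0%:R + a)| => // q; rewrite leqn0 => /eqP ->.
  exists (Num.min B `|rGamma (1 + Q.+1%:R + a)|); first by rewrite lt_min B0 f0.
  move=> q; rewrite leq_eqVlt => /predU1P[->|qQ]; first by rewrite ge_min lexx orbT.
  by rewrite ge_min IH.
pose Q := (Num.truncn `|a|).+1.
have [B B0 HB] := initial Q; exists B => // q.
have [/HB//|Qq] := leqP q Q.
rewrite -(subnKC (ltnW Qq)); elim: (q - Q)%N => [|r IH]; first by rewrite addn0 HB.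
rewrite addnS -natr1 (_ : 1 + ((Q + r)%:R + 1) + a = 1 + (Q + r)%:R + a + 1); last by ring.
rewrite rGamma_feq; last by apply: contra (ni (Q + r)%N) => /eqP ->; exact: rpred0.
rewrite normrM; apply: (le_trans IH); rewrite ler_peMl//.
have aQ : `|a| < Q%:R by exact: truncnS_gt.
have : - a <= `|a| by rewrite -normrN ler_norm.
rewrite natrD; have r0 : (0 : R) <= r%:R by [].
move=> ha; rewrite ger0_norm; lra.
Qed.

Lemma sin_shift_nat a (q : nat) : sin (pi * (a - q%:R)) = (-1) ^+ q * sin (pi * a).
Proof.
elim: q => [|q IH]; first by rewrite subr0 mul1r.
have := sinDpi (pi * (a - q.+1%:R)).
rewrite (_ : pi * (a - q.+1%:R) + pi = pi * (a - q%:R)); last by rewrite -natr1; ring.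
by rewrite IH exprS -mulrA => ->; rewrite mulN1r opprK.
Qed.

Definition real_term n (p : 'I_n -> R) x (j : 'I_n) (q : nat) : R :=
  (-1) ^+ (n * q) * x ^+ q / (q`!%:R * \prod_(m < n | m != j) rGamma (1 + q%:R + p j - p m)).

Lemma residue_term_real n (p : 'I_n -> R) x j q :
  residue_term p x j q = (real_term p x j q)%:C.
Proof.
rewrite /residue_term /real_term fmorph_div; congr (_ / _).
rewrite rmorphM /= -(rmorph_nat (real_complex R)); congr (_ * _).
by rewrite rmorph_prod; apply: eq_bigr => m _; exact: Gamma_real.
Qed.

(** Each of the [j] factors with [m < j] changes sign when its argument is reversed; this is the
    alternating sign of [residue_coef]. *)
Lemma prod_sin n (p : 'I_n -> R) (j : 'I_n) :
  \prod_(m < n | m != j) sin (pi * (p m - p j)) =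
  (-1) ^+ j * (\prod_(m < n | (m < j)%N) sin (pi * (p j - p m)) *
   \prod_(m < n | (j < m)%N) sin (pi * (p m - p j))).
Proof.
rewrite (bigID (fun m : 'I_n => (m < j)%N))/= mulrA; congr (_ * _); last first.
  by apply: eq_bigl => m; rewrite -leqNgt ltn_neqAle eq_sym -val_eqE.
have -> : (-1) ^+ j = \prod_(m < n | (m < j)%N) (-1) :> R.
  by rewrite -(big_ord_widen n (fun=> -1) (ltnW (ltn_ord j))) prodr_const card_ord.
rewrite -big_split /=; apply: eq_big => [m|m _].
  by rewrite andbC; case: ltnP => //= mj; rewrite -val_eqE neq_ltn mj.
by rewrite mulN1r -sinN -mulrN opprB.
Qed.

Lemma residue_real n (p : 'I_n -> R) (x : R) j q : (0 < n)%N -> 0 < x ->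
  (forall i j, i != j -> p i - p j \isn't a Num.int) ->
  residue p (ln x) j q = (residue_coef p x j * real_term p x j q)%:C.
Proof.
move=> n0 x0 pint.
have nint m : m != j -> p m - p j - q%:R \isn't a Num.int.
  by move=> mj; apply: contra (pint m j mj) => h; rewrite -(subrK q%:R (_ - _)) rpredD// rpred_nat.
have sin0 m : m != j -> sin (pi * (p m - p j)) != 0.
  move=> mj; apply/eqP => E; have := reflection (pint m j mj).
  by rewrite E mulr0 => /esym/eqP; rewrite gt_eqF// pi_gt0.
rewrite /residue.
have -> : \prod_(m < n | m != j) Gamma ((- (p j + q%:R))%:C + (p m)%:C) =
    (\prod_(m < n | m != j) rGamma (p m - p j - q%:R))%:C.
  rewrite rmorph_prod; apply: eq_bigr => m _; rewrite -rmorphD /= -Gamma_real.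
  by congr (Gamma _%:C); ring.
rewrite -rmorphM; congr (_%:C).
have -> : \prod_(m < n | m != j) rGamma (p m - p j - q%:R) =
    \prod_(m < n | m != j) ((pi * (-1) ^+ q) * (sin (pi * (p m - p j)))^-1 *
       (rGamma (1 + q%:R + p j - p m))^-1).
  apply: eq_bigr => m mj; have := reflection (nint m mj).
  rewrite sin_shift_nat (_ : 1 - (p m - p j - q%:R) = 1 + q%:R + p j - p m); last by ring.
  have g0 : rGamma (1 + q%:R + p j - p m) != 0.
    apply: rGamma_neq0; apply: contra (nint m mj) => h.
    rewrite (_ : p m - p j - q%:R = 1 - (1 + q%:R + p j - p m)); last by ring.
    by rewrite rpredB// rpred1.
  have s2 : (-1) ^+ q * (-1) ^+ q = 1 :> R by rewrite -exprD addnn -signr_odd odd_double expr0.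
  move: ((-1) ^+ q) s2 (sin _) (sin0 m mj) (rGamma _) (rGamma _) g0 => e e2 s s0 A B B0 <-.
  transitivity (e * e * A); first by rewrite e2 mul1r.
  by field; rewrite s0 B0.
have cardj : #|[pred m : 'I_n | m != j]| = n.-1.
  by rewrite (@eq_card _ _ (predC1 j))// cardC1 card_ord.
rewrite big_split big_split /= !prodfV prodr_const prod_sin cardj exprMn.
rewrite /residue_coef /real_term.
have -> : expR ((p j + q%:R) * ln x) = x `^ p j * x ^+ q.
  by rewrite mulrDl expRD expRM_natl lnK ?posrE// /powR gt_eqF.
(* One sign comes from the residue of the [j]-th factor, the other [n - 1] from the sines shifted by
   [q]. *)
have -> : (-1) ^+ (n * q) = (-1) ^+ q * ((-1) ^+ q) ^+ n.-1 :> R.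
  by rewrite -exprS prednK// -exprM mulnC.
have -> : (-1) ^+ j = ((-1) ^+ j)^-1 :> R.
  by rewrite -exprVn invrN invr1.
rewrite !invfM invrK.
move: (\prod_(i < n | (i < j)%N) _)^-1 (\prod_(i < n | (j < i)%N) _)^-1 => S1 S2.
move: (\prod_(i < n | i != j) _)^-1 (q`!%:R^-1) => G F.
rewrite (_ : (-1) ^- j = (-1) ^+ j); first by ring.
by rewrite -exprVn invrN invr1.
Qed.

Lemma cvg_sum_ord n (u : 'I_n -> nat -> R) (l : 'I_n -> R) :
  (forall j, u j @ \oo --> l j) ->
  (fun k => \sum_(j < n) u j k) @ \oo --> \sum_(j < n) l j.
Proof.
move=> ul; elim: (index_enum _) => [|j s IH].
  by rewrite big_nil; under eq_fun do rewrite big_nil; exact: cvg_cst.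
by rewrite big_cons; under eq_fun do rewrite big_cons; apply: cvgD.
Qed.

Lemma prod_lower (I : Type) (s : seq I) (P : pred I) (f : I -> nat -> R) :
  (forall m, P m -> exists2 B : R, 0 < B & forall q, B <= `|f m q|) ->
  exists2 B : R, 0 < B & forall q, B <= `|\prod_(m <- s | P m) f m q|.
Proof.
move=> H; elim: s => [|m s [B B0 HB]].
  by exists 1 => // q; rewrite big_nil normr1.
have [Pm|nPm] := boolP (P m); last by exists B => // q; rewrite big_cons (negbTE nPm).
have [A A0 HA] := H m Pm; exists (A * B); first exact: mulr_gt0.
by move=> q; rewrite big_cons Pm normrM ler_pM// ltW.
Qed.

Lemma real_term_cvg n (p : 'I_n -> R) x j : 0 < x ->
  (forall i j, i != j -> p i - p j \isn't a Num.int) -> cvgn (series (real_term p x j)).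
Proof.
move=> x0 pint.
have [|B B0 HB] := @prod_lower _ (index_enum 'I_n) (fun m => m != j)
    (fun m q => rGamma (1 + q%:R + p j - p m)).
  move=> m mj; have jm : p j - p m \isn't a Num.int by apply: pint; rewrite eq_sym.
  have [B B0 HB] := rGamma_lower jm; exists B => // q.
  by have := HB q; rewrite addrA.
have bound q : `|real_term p x j q| <= B^-1 * exp_coeff x q.
  have F0 : 0 < q`!%:R :> R by rewrite ltr0n fact_gt0.
  rewrite /real_term /exp_coeff /= normrM normrMsign normfV (normrM q`!%:R).
  rewrite (ger0_norm (exprn_ge0 q (ltW x0))) (gtr0_norm F0) [leRHS]mulrC -mulrA.
  apply: ler_wpM2l; first by rewrite exprn_ge0// ltW.
  rewrite -invfM lef_pV2 ?posrE.
  - by rewrite ler_pM2l.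
  - by rewrite mulr_gt0// (lt_le_trans B0 (HB q)).
  - exact: mulr_gt0.
apply: normed_cvg; apply: (@series_le_cvg _ _ (fun q => B^-1 * exp_coeff x q)).
- by move=> q; exact: normr_ge0.
- by move=> q; apply: le_trans (bound q); exact: normr_ge0.
- exact: bound.
- exact: is_cvg_seriesZ (is_cvg_series_exp_coeff x).
Qed.

Lemma cvg_real_complex (u : nat -> R) (l : R) : u @ \oo --> l ->
  (fun n => (u n)%:C : R[i]^o) @ \oo --> (l%:C : R[i]^o).
Proof.
move=> /cvgrPdist_lt ul; apply/cvgrPdist_lt => e e0.
(* The radius [e] is an element of [R[i]]; being positive, it is real. *)
have eE : e = (Re e)%:C by rewrite -(RRe_real (gtr0_real e0)).
have e0' : 0 < Re e by move: e0; rewrite eE ltcR.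
near=> n; rewrite eE -rmorphB normc_def /= expr0n addr0 sqrtr_sqr ltcR.
by near: n; exact: ul.
Unshelve. all: by end_near. Qed.

Lemma residue_term_cvg n (p : 'I_n -> R) x j : 0 < x ->
  (forall i j, i != j -> p i - p j \isn't a Num.int) ->
  cvgn (series (residue_term p x j)) /\
  limn (series (residue_term p x j)) = (limn (series (real_term p x j)))%:C.
Proof.
move=> x0 pint; have cv := @real_term_cvg n p x j x0 pint.
have E : series (residue_term p x j) = (fun n => (series (real_term p x j) n)%:C : R[i]^o).
  apply/funext => k; rewrite /series /= rmorph_sum.
  by apply: eq_bigr => q _; exact: residue_term_real.
have H := cvg_real_complex cv.
rewrite E; split; first by apply/cvg_ex; eexists; exact: H.
exact: (cvg_lim _ H).
Qed.

Lemma inversion_series n (p : 'I_n -> R) (x a : R) : (0 < n)%N -> 0 < x ->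
  (forall m, 0 < p m) ->
  (forall i j, i != j -> p i - p j \isn't a Num.int) ->
  inversion (gamma_product p) 1 (ln x) = a%:C ->
  a = \sum_(j < n) residue_coef p x j * limn (series (real_term p x j)).
Proof.
move=> n0 x0 p0 pint Ea.
have [c [K HK]] := exists_generic p.
have [A [r Hr]] := inversion_shift_bound (ln x) n0 HK.
have r0 : r @ \oo --> (0 : R).
  have l : (fun k => A * (expR (ln x) ^+ k / k`!%:R)) @ \oo --> (0 : R).
    rewrite -(mulr0 A); apply: cvgM; first exact: cvg_cst.
    exact: cvg_exp_coeff.
  have z : (fun _ : nat => 0 : R) @ \oo --> (0 : R) by exact: cvg_cst.
  apply/norm_cvg0P; apply: (squeeze_cvgr _ z l).
  by apply: nearW => k; rewrite normr_ge0/=; have [_] := Hr k.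
(* Between the lines at 1 and at [c - k] the [j]-th factor has [K j + k] poles. The partial sums
   have different lengths, but the offset [K j] is fixed and does not change the limit. *)
have E (k : nat) : a - r k = \sum_(j < n) residue_coef p x j * series (real_term p x j) (k + K j)%N.
  apply: (@complexI R); rewrite rmorphB /= -Ea; have [<- _] := Hr k.
  rewrite (@sum_residues _ _ (fun m => K m + k)%N)//; first last.
  - by move=> m; case: (HK m) => _; exact.
  - by move=> m; rewrite addr_gt0.
  rewrite rmorph_sum; apply: eq_bigr => j _.
  rewrite rmorphM /series /= rmorph_sum mulr_sumr big_mkord addnC.
  by apply: eq_bigr => q _; rewrite residue_real// rmorphM.
have l1 : (fun k => a - r k) @ \oo --> a.
  by rewrite -[X in _ --> X]subr0; apply: cvgB; [exact: cvg_cst|exact: r0].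
have l2 : (fun k => a - r k) @ \oo --> \sum_(j < n) residue_coef p x j * limn (series (real_term p x j)).
  under eq_fun do rewrite E.
  apply: cvg_sum_ord => j; apply: cvgM; first exact: cvg_cst.
  have := @real_term_cvg n p x j x0 pint.
  by rewrite -(cvg_shiftn (K j)).
exact: (cvg_unique _ l1 l2).
Qed.

(** * Return to the multiplicative coordinate *)

Lemma bromwich_integrandE (P : R[i] -> R[i]) c (x : R) t :
  bromwich_integrand P c x t = (expR (- (c * ln x)))%:C * (P (c +i* t) * cis (- ln x * t)).
Proof.
rewrite /bromwich_integrand /cpow raddfN raddfN /= mulrCA mulNr; congr (_ * (_ * _)).
by rewrite /cis mulNr mulrC mulNr.
Qed.

Lemma inverse_mellinE (P : R[i] -> R[i]) c (x : R) : CL1 (fun t => P (c +i* t)) ->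
  cintegrable setT (bromwich_integrand P c x) /\
  inverse_mellin P c x = inversion P c (ln x).
Proof.
move=> lP.
have E : bromwich_integrand P c x = (fun t => (expR (- (c * ln x)))%:C * (P (c +i* t) * cis (- ln x * t))).
  by apply/funext => t; exact: bromwich_integrandE.
have l := CL1_cis (- ln x) lP.
split; first by rewrite E; exact: CL1Z.
rewrite /inverse_mellin E CIntZ// /inversion.
have i0 : (0 +i* 1 : R[i]) != 0 by rewrite eq_complex /= oner_eq0 andbF.
have p0 : pi%:C != 0 :> R[i] by rewrite fmorph_eq0 gt_eqF// pi_gt0.
have -> : (expR (- (c * ln x)) / (pi *+ 2))%:C = (expR (- (c * ln x)))%:C / (2 * pi%:C).
  by rewrite -(mulr_natl pi 2) (fmorph_div (real_complex R)) rmorphM rmorph_nat.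
move: pi%:C p0 (0 +i* 1 : R[i]) i0 => q q0 i i0.
by field; rewrite i0 q0.
Qed.

Lemma mellin_pair_continuous (h : R -> R) P S c : mellin_pair h P S -> S c -> continuous h.
Proof.
move=> hP /hP[_ _ lP iP].
have -> : h = (fun x => expR (- c * x) * weighted h c x).
  by apply/funext => x; rewrite /weighted mulrA mulNr expRN mulVf ?mul1r// gt_eqF// expR_gt0.
apply: continuous_mul; last exact: (inversion_continuous lP iP).
by apply: continuous_comp1; [exact: continuous_expR|exact: continuous_lin].
Qed.

End real_line_integrals.

Theorem mainTheorem18 (R : realType) (n : nat) (p : 'I_n -> R)
    (n_gt0 : (0 < n)%N) (p_gt0 : forall j, 0 < p j) (p_inj : injective p) :
  exists g : R -> R[i],
    [/\ forall s : R[i], (forall j, 0 < complex.Re s + p j) ->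
          cintegrable `]0, +oo[ (mellin_integrand g s) /\
          gamma_product p s = mellin g s,
        forall c u : R, 0 < c -> 0 < u ->
          cintegrable setT (bromwich_integrand (gamma_product p) c u) /\
          g u = inverse_mellin (gamma_product p) c u
      & (forall i j : 'I_n, i != j -> p i - p j \isn't a Num.int) ->
        forall u : R, 0 < u ->
          (forall j, cvgn (series (residue_term p u j))) /\
          g u = \sum_(j < n)
                  (residue_coef p u j)%:C * limn (series (residue_term p u j))].
Proof.
have enum_neq : enum 'I_n != [::] by rewrite -size_eq0 size_enum_ord -lt0n.
(* With no Taylor term removed, the strips are the half planes [0 < c + p j]. *)
have [h0 H0] := gamma_product_pair p (fun=> 0%N) enum_neq.
have {H0} [h hP] : exists h : R -> R,
    mellin_pair h (gamma_product p) (fun c => forall j, 0 < c + p j).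
  exists h0; apply: (mellin_pair_sub H0) => [z|c cp j _].
    by rewrite /gamma_product big_enum.
  by rewrite strip0.
have pos c : 0 < c -> forall j, 0 < c + p j by move=> c0 j; rewrite addr_gt0.
have ch : continuous h := mellin_pair_continuous hP (pos 1 ltr01).
(* Only [u > 0] matters; elsewhere [ln] has a default value. *)
exists (fun u => (h (ln u))%:C); split.
- move=> s sp; have [lw hw _ _] := hP (complex.Re s) sp.
  have [ig E] := mellin_hat ch (fun x _ => erefl _) lw.
  split; first exact: ig.
  by rewrite E [LHS](_ : _ = gamma_product p (complex.Re s +i* complex.Im s)) ?hw//; case: (s).
- move=> c u c0 u0; have [_ _ lP _] := hP c (pos c c0).
  have [ig ->] := inverse_mellinE u lP; split; first exact: ig.
  by rewrite (mellin_pair_inversion _ hP (pos c c0)).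
- move=> pint u u0; split; first by move=> j; have [] := residue_term_cvg j u0 pint.
  (* The line [Re s = 1] is one of those to the right of all poles; each of them has the same
     inverse [h]. *)
  have E := mellin_pair_inversion (ln u) hP (pos 1 ltr01).
  rewrite (inversion_series n_gt0 u0 p_gt0 pint E) rmorph_sum.
  apply: eq_bigr => j _; have [_ ->] := residue_term_cvg j u0 pint.
  by rewrite rmorphM.
Qed.
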